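(* Let $\mathsf{k}$ be an $F$-finite field of positive characteristic. Let $n\ge1$ and let $\mathbf b=(b_1,\dots,b_n)$ be a vector of positive integers such that $b_1\ge b_2\ge\cdots\ge b_n$. Let $$A=\int_0^{1-1/b_1}\int_0^{1/b_1}\prod_{i=1}^n(1-b_iv)\,dv\,du,\qquad B=\int_0^{1/b_1}\sum_{i=0}^n(-1)^iS_i(b_1,\dots,b_n)\frac{u^{i+1}}{i+1}\,du .$$ For an integer $k\ge1$, the $F$-signature of $\mathcal B(k\cdot\mathbf b,\mathbf b)$, where $k\cdot\mathbf b=(kb_1,\dots,kb_n)$, equals $$\frac1k\left(\left(\frac{2b_1-1}{b_1-1}\right)A+B\right)\quad\text{when } k\ge2 \text{ and } b_1\ge2,$$ $$\frac1k\left(\sum_{i=0}^n(-1)^i\frac{\binom ni}{i+1}+B\right)\quad\text{when } k\ge2\text{ and } b_1=1,$$ and $$2(A+B)\quad\text{when }k=1,\text{ and in particular } 2B\text{ if } k=1 \text{ and } b_1=1.$$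
   Context: $\mathbb N=\mathbb Z_{\ge 0}$. $S_i(b_1,\dots,b_n)$ denotes the elementary symmetric polynomial of degree $i$ in $b_1,\dots,b_n$ (with $S_0=1$). For vectors $\mathbf a=(a_1,\dots,a_n),\mathbf b=(b_1,\dots,b_n)$ of positive integers let $R=\mathsf{k}[x_1,\dots,x_n]$, $I=(x_1^{a_1}\cdots x_n^{a_n})$, $J=(x_1^{b_1}\cdots x_n^{b_n})$. The intersection algebra is $\mathcal B(\mathbf a,\mathbf b)=\bigoplus_{r,s\in\mathbb N}(I^r\cap J^s)$, realized as the subring $\sum_{r,s}(I^r\cap J^s)u^rv^s$ of $R[u,v]$; it is a normal domain of dimension $n+2$ with homogeneous maximal ideal $\mathfrak m$ generated by its monomials $\ne1$. A field of characteristic $p>0$ is $F$-finite if $[\mathsf{k}:\mathsf{k}^p]<\infty$. The $F$-signature of $\mathcal B$ as a graded ring is that of $\mathcal B_{\mathfrak m}$: $\lim_{e\to\infty} c_e/p^{e(d+\alpha)}$, where $d=\dim\mathcal B$, $p^\alpha=[\mathsf{k}:\mathsf{k}^p]$, and $c_e$ is the maximal rank of a free direct summand of $F^e_*\mathcal B_{\mathfrak m}$ as a $\mathcal B_{\mathfrak m}$-module. *)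

(* Defs.v *)
From HB Require Import structures.
From mathcomp Require Import all_boot all_order all_algebra ring_quotient.
From mathcomp Require Import all_classical.
From mathcomp Require mpoly.

Set Implicit Arguments.
Unset Strict Implicit.
Unset Printing Implicit Defensive.

Import Order.TTheory GRing.Theory Num.Theory.

Local Open Scope classical_set_scope.
Local Open Scope ring_scope.

Section CommutativeAlgebra.

Definition ideal_gen (A : comNzRingType) (G : set A) : set A :=
  [set f | exists (N : nat) (c g : 'I_N -> A),
     (forall i, G (g i)) /\ f = \sum_(i < N) c i * g i].

Definition ideal_exp (A : comNzRingType) (I : set A) (r : nat) : set A :=
  ideal_gen [set f | exists g : 'I_r -> A,
     (forall i, I (g i)) /\ f = \prod_(i < r) g i].

(* [idealr_closed] already requires the ideal to be proper. *)
Definition is_prime_ideal (A : comNzRingType) (P : {pred A}) : Prop :=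
  idealr_closed P /\ prime_idealr_closed P.

(* P 0 < P 1 < ... < P d; the values of P above d are irrelevant. *)
Definition prime_chain (A : comNzRingType) (d : nat) (P : nat -> {pred A}) :
    Prop :=
  (forall i, (i <= d)%N -> is_prime_ideal (P i)) /\
  (forall i, (i < d)%N ->
     {subset P i <= P i.+1} /\ exists2 x, x \in P i.+1 & x \notin P i).

Definition is_krull_dim (A : comNzRingType) (d : nat) : Prop :=
  (exists P, @prime_chain A d P) /\
  (forall d' P, @prime_chain A d' P -> (d' <= d)%N).

(* D = [K : K^p], i.e. K has a basis of D elements over its subfield K^p. *)
Definition is_frobenius_degree (K : fieldType) (p D : nat) : Prop :=
  exists w : 'I_D -> K, forall x : K,
    exists! c : {ffun 'I_D -> K},
      (forall i, exists y, c i = y ^+ p) /\ x = \sum_i c i * w i.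

Definition F_finite (K : fieldType) (p : nat) : Prop :=
  exists D, is_frobenius_degree K p D.

(* F^e_* A: the additive group A on which a acts as multiplication by
   a ^ (p ^ e). *)
Definition Frobenius_push (A : comNzRingType) (p : nat)
  (chA : p \in [pchar A]) (e : nat) : Type := A.

Section FrobeniusPush.
Context (A : comNzRingType) (p : nat) (chA : p \in [pchar A]) (e : nat).

HB.instance Definition _ := GRing.Zmodule.on (Frobenius_push chA e).

Definition Frobenius_scale (a : A) (x : Frobenius_push chA e) :
  Frobenius_push chA e := (a ^+ (p ^ e) * (x : A) : A).

Lemma Frobenius_scaleA a b x :
  Frobenius_scale a (Frobenius_scale b x) = Frobenius_scale (a * b) x.
Proof. by rewrite /Frobenius_scale exprMn mulrA. Qed.

Lemma Frobenius_scale1 : left_id 1 Frobenius_scale.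
Proof. by move=> x; rewrite /Frobenius_scale expr1n mul1r. Qed.

Lemma Frobenius_scaleDr : right_distributive Frobenius_scale +%R.
Proof. by move=> a x y; rewrite /Frobenius_scale; exact: (@mulrDr A). Qed.

Lemma Frobenius_scaleDl x : {morph Frobenius_scale^~ x : a b / a + b}.
Proof.
move=> a b; rewrite /Frobenius_scale exprDn_pchar; first exact: (@mulrDl A).
by rewrite pnatX (eq_pnat _ (pcharf_eq chA)) pnat_id ?(pcharf_prime chA).
Qed.

HB.instance Definition _ := GRing.Zmodule_isLmodule.Build A
  (Frobenius_push chA e)
  Frobenius_scaleA Frobenius_scale1 Frobenius_scaleDr Frobenius_scaleDl.

End FrobeniusPush.

(* M is isomorphic to A^c (+) N for some A-module N. *)
Definition has_free_summand (A : comNzRingType) (M : lmodType A) (c : nat) :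
    Prop :=
  exists (N : lmodType A) (f : {linear M -> ('rV[A]_c * N)%type}), bijective f.

Definition is_max_free_rank (A : comNzRingType) (M : lmodType A) (c : nat) :
    Prop :=
  has_free_summand M c /\ forall c', has_free_summand M c' -> (c' <= c)%N.

End CommutativeAlgebra.

Local Notation "x %:F" := (FracField.tofrac x).

Section FractionLemmas.
Context (S : idomainType).
Implicit Types f g s t : S.

Lemma fraction1 : 1 = (1 : S)%:F / (1 : S)%:F.
Proof. by rewrite tofrac1 divr1. Qed.

Lemma fractionB f g s t : s != 0 -> t != 0 ->
  f%:F / s%:F - g%:F / t%:F = (f * t - g * s)%:F / (s * t)%:F.
Proof.
move=> s0 t0; rewrite -mulNr addf_div ?tofrac_eq0 //.
by rewrite mulNr tofracB !tofracM.
Qed.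

Lemma fractionM f g s t :
  f%:F / s%:F * (g%:F / t%:F) = (f * g)%:F / (s * t)%:F.
Proof. by rewrite mulf_div !tofracM. Qed.

End FractionLemmas.

Section IntersectionAlgebra.
(* The notations of mpoly clash with those of mathcomp-analysis, hence the
   local import. *)
Import mpoly.

Context (K : fieldType) (n : nat) (a b : 'I_n -> nat).

Definition xmon (c : 'I_n -> nat) : {mpoly K[n]} := 'X_[[multinom c i | i < n]].

Definition monomial_ideal (c : 'I_n -> nat) : set {mpoly K[n]} :=
  ideal_gen [set xmon c].

(* R[u,v] with R = K[x_1, ..., x_n]: the coefficient of u^r v^s in f is f@_m
   for the multi-index m with m 0 = r and m 1 = s. *)
Definition intersection_pred : {pred {mpoly {mpoly K[n]}[2]}} :=
  fun f => `[< forall m : 'X_{1..2},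
    (ideal_exp (monomial_ideal a) (m ord0) `&`
     ideal_exp (monomial_ideal b) (m ord_max)) f@_m >].

Lemma xmonD (c d : 'I_n -> nat) :
  xmon (fun i => c i + d i)%N = xmon c * xmon d.
Proof.
rewrite /xmon -mpolyXD; congr mpolyX.
by apply/mnmP => i; rewrite mnmDE !mnmE.
Qed.

Lemma xmon_exp (c : 'I_n -> nat) r :
  xmon (fun i => r * c i)%N = xmon c ^+ r.
Proof.
rewrite /xmon mpolyXn; congr mpolyX.
by apply/mnmP => i; rewrite mulmnE !mnmE mulnC.
Qed.

Lemma monomial_idealP c f :
  monomial_ideal c f <-> exists q, f = q * xmon c.
Proof.
split=> [[N [q [g [gc ->]]]]|[q ->]].
  exists (\sum_i q i); rewrite mulr_suml; apply: eq_bigr => i _.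
  by rewrite gc.
by exists 1%N, (fun=> q), (fun=> xmon c); rewrite big_ord1.
Qed.

Lemma ideal_expP c r f :
  ideal_exp (monomial_ideal c) r f <->
  exists q, f = q * xmon (fun i => r * c i)%N.
Proof.
rewrite xmon_exp; split=> [[N [q [g [gP ->]]]]|[q ->]].
  have h i : exists t, g i = t * xmon c ^+ r.
    have [w [wP ->]] := gP i.
    have /choice[t tP] : forall j, exists t, w j = t * xmon c.
      by move=> j; apply/monomial_idealP.
    exists (\prod_j t j); rewrite -[in xmon c ^+ r](card_ord r) -prodr_const.
    by rewrite -big_split; apply: eq_bigr => j _; rewrite tP.
  have [t tP] := choice h.
  exists (\sum_i q i * t i); rewrite mulr_suml; apply: eq_bigr => i _.
  by rewrite tP mulrA.
exists 1%N, (fun=> q), (fun=> xmon c ^+ r); rewrite big_ord1; split=> // _.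
exists (fun=> xmon c); rewrite prodr_const card_ord; split=> // _.
by apply/monomial_idealP; exists 1; rewrite mul1r.
Qed.

Lemma intersection_predP f :
  reflect (forall m : 'X_{1..2},
    (exists q, f@_m = q * xmon (fun i => m ord0 * a i)%N) /\
    (exists q, f@_m = q * xmon (fun i => m ord_max * b i)%N))
  (f \in intersection_pred).
Proof.
apply: (iffP (asboolP _)) => h m; have [h1 h2] := h m;
  by split; apply/ideal_expP.
Qed.

Lemma intersection_subring : subring_closed intersection_pred.
Proof.
have e0 (c : 'I_n -> nat) : xmon (fun i => 0 * c i)%N = 1.
  by rewrite xmon_exp expr0.
split.
- apply/intersection_predP => m; rewrite mcoeff1.
  have [->|_] := eqVneq m 0%MM.
    by rewrite !mnmE !e0; split; exists 1; rewrite mulr1.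
  by split; exists 0; rewrite mul0r.
- move=> f g /intersection_predP hf /intersection_predP hg.
  apply/intersection_predP => m; rewrite mcoeffB.
  have [[q1 e1] [q2 e2]] := hf m; have [[q3 e3] [q4 e4]] := hg m.
  split; first by exists (q1 - q3); rewrite e1 e3 mulrBl.
  by exists (q2 - q4); rewrite e2 e4 mulrBl.
- move=> f g /intersection_predP hf /intersection_predP hg.
  apply/intersection_predP => m; rewrite mcoeffM.
  have dvd (c : 'I_n -> nat) (k : 'I_2) :
      (forall m, exists q, f@_m = q * xmon (fun i => m k * c i)%N) ->
      (forall m, exists q, g@_m = q * xmon (fun i => m k * c i)%N) ->
      exists q, \sum_(d : 'X_{1..2 < (mdeg m).+1, (mdeg m).+1} | m == (d.1 + d.2)%MM)
        f@_d.1 * g@_d.2 = q * xmon (fun i => m k * c i)%N.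
    move=> /choice[q1 e1] /choice[q2 e2].
    exists (\sum_(d : 'X_{1..2 < (mdeg m).+1, (mdeg m).+1} | m == (d.1 + d.2)%MM)
      q1 d.1 * q2 d.2); rewrite mulr_suml; apply: eq_bigr => d /eqP h.
    have -> : m k = (d.1 k + d.2 k)%N by rewrite [LHS](congr1 (fun z : 'X_{1..2} => z k) h) mnmDE.
    by rewrite e1 e2 !xmon_exp exprD mulrACA.
  by split; [apply: (dvd a ord0) | apply: (dvd b ord_max)] => d;
    have [] := hf d; have [] := hg d.
Qed.

HB.instance Definition _ := GRing.isSubringClosed.Build
  {mpoly {mpoly K[n]}[2]} intersection_pred intersection_subring.

Record intersection_algebra := IntersectionAlgebra {
  ia_val :> {mpoly {mpoly K[n]}[2]};
  _ : ia_val \in intersection_pred }.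

HB.instance Definition _ := [isSub for ia_val].
HB.instance Definition _ := [Choice of intersection_algebra by <:].
HB.instance Definition _ :=
  [SubChoice_isSubComNzRing of intersection_algebra by <:].

(* The monomials x^c u^r v^s of R[u,v]. *)
Definition uvx_monomial (c : 'X_{1..n}) (m : 'X_{1..2}) :
  {mpoly {mpoly K[n]}[2]} := 'X_[c] *: 'X_[m].

Definition max_ideal : set intersection_algebra :=
  ideal_gen [set f | f != 1 /\ exists c m, val f = uvx_monomial c m].

Definition const_coeff (f : {mpoly {mpoly K[n]}[2]}) : K :=
  mcoeff 0%MM (mcoeff 0%MM f).

Lemma const_coeffM f g : const_coeff (f * g) = const_coeff f * const_coeff g.
Proof. by rewrite /const_coeff !rmorphM. Qed.

Lemma const_coeff_sum I r (F : I -> {mpoly {mpoly K[n]}[2]}) :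
  const_coeff (\sum_(i <- r) F i) = \sum_(i <- r) const_coeff (F i).
Proof. by rewrite /const_coeff !raddf_sum. Qed.

Lemma uvx_monomial_in (f : intersection_algebra) m c :
  c \in msupp (val f)@_m -> uvx_monomial c m \in intersection_pred.
Proof.
move=> cf; apply/intersection_predP => m'.
rewrite mcoeffZ mcoeffX; case: eqVneq => [<-|_]; last first.
  by rewrite mulr0; split; exists 0; rewrite mul0r.
have dvd (d : 'I_n -> nat) k :
    (exists q, (val f)@_m = q * xmon (fun i => k * d i)%N) ->
    exists q, 'X_[c] = q * xmon (fun i => k * d i)%N.
  move=> [q e]; move: cf; rewrite e /xmon (perm_mem (msuppMX _ _)).
  by case/mapP => c' _ ->; exists 'X_[c']; rewrite -mpolyXD addmC.
rewrite mulr1; have /intersection_predP/(_ m)[h1 h2] := valP f.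
by split; apply: dvd.
Qed.

Lemma max_idealP (f : intersection_algebra) :
  max_ideal f <-> const_coeff (val f) = 0.
Proof.
split=> [[N [q [g [gP ->]]]]|f0].
  rewrite raddf_sum const_coeff_sum big1 // => i _.
  have [g1 [c [m e]]] := gP i.
  suff gi0 : const_coeff (val (g i)) = 0.
    by apply: etrans (const_coeffM (val (q i)) (val (g i))) _; rewrite gi0 mulr0.
  rewrite e /const_coeff mcoeffZ mcoeffX.
  have [m0|_] := eqVneq m 0%MM; last by rewrite mulr0 mcoeff0.
  rewrite mulr1 mcoeffX; have [c0|//] := eqVneq c 0%MM.
  case/negP: g1; apply/eqP/val_inj.
  by rewrite e rmorph1 /uvx_monomial m0 c0 !mpolyX0 scale1r.
pose s := [seq (m, c) | m <- msupp (val f), c <- msupp (val f)@_m].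
have fE : val f = \sum_(t <- s) (((val f)@_t.1)@_t.2)%:MP *: uvx_monomial t.2 t.1.
  rewrite big_allpairs_dep [LHS]mpolyE; apply: eq_bigr => m _ /=.
  rewrite [in LHS](mpolyE (val f)@_m) scaler_suml; apply: eq_bigr => c _.
  by rewrite /uvx_monomial scalerA mul_mpolyC.
have cP (z : K) : (z%:MP)%:MP \in intersection_pred.
  apply/intersection_predP => m; rewrite mcoeffC.
  have [<-|_] := eqVneq 0%MM m; last first.
    by rewrite mulr0; split; exists 0; rewrite mul0r.
  by rewrite !mnmE !xmon_exp !expr0; split; eexists; rewrite mulr1.
have sP i : (i < size s)%N ->
    uvx_monomial (nth (0, 0)%MM s i).2 (nth (0, 0)%MM s i).1
      \in intersection_pred /\ nth (0, 0)%MM s i != (0, 0)%MM.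
  move=> si; have := mem_nth (0, 0)%MM si; move: (nth _ s i) => t.
  case/allpairsPdep => m [c [mf cf ->]] /=; split.
    exact: uvx_monomial_in cf.
  apply/eqP => -[m0 c0]; move: cf; rewrite m0 c0 mcoeff_msupp.
  by rewrite -/(const_coeff _) f0 eqxx.
pose t (i : 'I_(size s)) := nth (0, 0)%MM s i.
exists (size s).
exists (fun i : 'I_(size s) => IntersectionAlgebra (cP (((val f)@_(t i).1)@_(t i).2))).
exists (fun i : 'I_(size s) => IntersectionAlgebra (sP i (ltn_ord i)).1).
split=> [i|].
  have [h ne] := sP i (ltn_ord i).
  split; last by exists (t i).2, (t i).1.
  apply/eqP => /(congr1 val); rewrite rmorph1 /= => /(congr1 (mcoeff (t i).1)).
  rewrite mcoeffZ mcoeffX eqxx mulr1 mcoeff1; case: eqVneq => [t1|_].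
    move/(congr1 (mcoeff (t i).2)); rewrite mcoeffX eqxx mcoeff1.
    case: eqVneq => [t2 _|_ /eqP]; last by rewrite oner_eq0.
    case/negP: ne; rewrite -/(t i); apply/eqP.
    by rewrite [LHS]surjective_pairing t1 t2.
  by move/(congr1 (mcoeff (t i).2))/eqP; rewrite mcoeffX eqxx mcoeff0 oner_eq0.
apply: val_inj; rewrite raddf_sum [LHS]fE (big_nth (0, 0)%MM) big_mkord.
by apply: eq_bigr => i _; exact/esym/mul_mpolyC.
Qed.

(* B_m, realized inside the fraction field of R[u,v], which contains B. *)
Definition local_pred : {pred {fraction {mpoly {mpoly K[n]}[2]}}} :=
  fun x => `[< exists f s : intersection_algebra,
    ~ max_ideal s /\ x = (val f)%:F / (val s)%:F >].

Lemma local_subring : subring_closed local_pred.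
Proof.
have nz s : ~ max_ideal s -> val s != 0.
  move=> ms; apply/eqP => s0; apply: ms.
  by apply/max_idealP; rewrite s0 /const_coeff !mcoeff0.
have mM s t : ~ max_ideal s -> ~ max_ideal t -> ~ max_ideal (s * t).
  move=> /max_idealP/eqP ms /max_idealP/eqP mt /max_idealP/eqP.
  by rewrite rmorphM const_coeffM mulf_eq0 (negPf ms) (negPf mt).
split.
- apply/asboolP; exists 1, 1; split.
    by move=> /max_idealP/eqP; rewrite rmorph1 /const_coeff !rmorph1 oner_eq0.
  exact: fraction1.
- move=> _ _ /asboolP[f [s [ms ->]]] /asboolP[g [t [mt ->]]].
  apply/asboolP; exists (f * t - g * s), (s * t); split; first exact: mM.
  exact: (fractionB (val f) (val g) (nz s ms) (nz t mt)).
- move=> _ _ /asboolP[f [s [ms ->]]] /asboolP[g [t [mt ->]]].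
  apply/asboolP; exists (f * g), (s * t); split; first exact: mM.
  exact: (fractionM (val f) (val g) (val s) (val t)).
Qed.

HB.instance Definition _ := GRing.isSubringClosed.Build
  {fraction {mpoly {mpoly K[n]}[2]}} local_pred local_subring.

Record local_algebra := LocalAlgebra {
  la_val :> {fraction {mpoly {mpoly K[n]}[2]}};
  _ : la_val \in local_pred }.

HB.instance Definition _ := [isSub for la_val].
HB.instance Definition _ := [Choice of local_algebra by <:].
HB.instance Definition _ := [SubChoice_isSubComNzRing of local_algebra by <:].

Lemma pchar_local p : p \in [pchar K] -> p \in [pchar local_algebra].
Proof.
move=> /(rmorph_pchar (@mpolyC n K)) /(rmorph_pchar (@mpolyC 2 _)).
move=> /(rmorph_pchar (@FracField.tofrac _)) /andP[pp /eqP p0].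
rewrite inE /= pp; apply/eqP/val_inj; rewrite rmorph_nat rmorph0; exact: p0.
Qed.

End IntersectionAlgebra.

From mathcomp Require Import all_reals all_analysis.
Import numFieldNormedType.Exports.

(* The F-signature of B(a, b), as a graded ring, exists and equals s.  The
   real number alpha is log_p [K : K^p]. *)
Definition is_F_signature (R : realType) (K : fieldType) (p : nat)
    (chK : p \in [pchar K]) (n : nat) (a b : 'I_n -> nat) (s : R) : Prop :=
  exists (d D : nat) (alpha : R) (c : nat -> nat),
    [/\ is_krull_dim (intersection_algebra K a b) d,
        is_frobenius_degree K p D /\ p%:R `^ alpha = D%:R,
        forall e,
          is_max_free_rank (Frobenius_push (pchar_local a b chK) e) (c e)
      & (fun e => (c e)%:R / p%:R `^ (e%:R * (d%:R + alpha))) @ \oo --> s].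

Definition elementary_symmetric (R : realType) (n : nat) (b : 'I_n -> nat)
    (i : nat) : R :=
  mpoly.meval (fun j => (b j)%:R) (mpoly.mesym n R i).

(* Main.v *)
Require Import Defs.
From HB Require Import structures.
From mathcomp Require Import all_boot all_order all_algebra ring_quotient.
From mathcomp Require Import all_classical.
From mathcomp Require mpoly.
From mathcomp Require Import ring lra zify.

Set Implicit Arguments.
Unset Strict Implicit.
Unset Printing Implicit Defensive.

Import Order.TTheory GRing.Theory Num.Theory.

Local Open Scope ring_scope.

(** Why the theorem is true.

    Write q = p^e.  B = B(a, b) is spanned over K by the monomials x^c u^r v^s
    with c_i >= r a_i and c_i >= s b_i, that is, by the lattice points of a cone
    whose facets are r = 0, s = 0, c_i = r a_i and c_i = s b_i.

    The free rank of F^e_* B_m.  Let w_1, ..., w_(D^e) be a basis of K over its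
    q-th powers.  As a B_m-module F^e_* B_m is generated by the w_t x^c u^r v^s.
    Call such a monomial splitting if each of the facet forms r, s, c_i - r a_i,
    c_i - s b_i takes a value in [0, q) on it.
    - A splitting monomial is a free generator: reading off the coefficients at
      the exponents (c, r, s) + q (c', r', s') and taking q-th roots along w_t is
      a linear form F^e_* B -> B ([extract_semilinear]), and on the splitting
      monomials these forms are the dual basis.
    - If some facet form takes a value >= q, the monomial can be divided by the
      q-th power of a Laurent monomial on which that facet form is 1 and the
      others are <= 0.  A linear form taking a unit value on it would put this
      Laurent monomial's inverse in B_m, so all linear forms send it into m
      ([nonsplitting_term]).
    Hence modulo m the matrix of values of linear forms factors through the
    splitting monomials, and the free rank is D^e times their number
    ([Frobenius_max_free_rank]).  For given r and s there are
    max(0, q - |r a_i - s b_i|) choices of c_i, so the rank is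
    D^e \sum_(r, s < q) \prod_i max(0, q - |r a_i - s b_i|).

    The dimension is n + 2.  Setting u, v, x_1, ..., x_n to zero one after the
    other gives a chain of primes of that length.  A longer chain is impossible:
    elements y_i picked in the successive differences of a chain of primes
    satisfy no polynomial relation over K ([chain_independent]), while any
    n + 3 elements of a polynomial ring in n + 2 variables satisfy one
    ([algebraic_dependence]).

    The limit.  With a = k b and g(t) = \prod_i max(0, 1 - b_i |t|), the quotient
    of the rank by q^(n+2) D^e is the Riemann sum, with mesh 1/q, of g(k r - s)
    over the unit square.  Since b_1 is the largest b_i and the product
    \prod_i (1 - b_i t) vanishes at 1/b_1, g is this polynomial composed with
    t |-> min(|t|, 1/b_1); it has explicit piecewise polynomial first and second
    antiderivatives, G (odd) and H (even).  Two Riemann sum estimates give the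
    limit (H(k) - H(k-1) - H(0) + H(1)) / k ([band_sum_approx]), with H(0) = 0.
    Beyond 1/b_1 the function H is affine,
    H(t) = H(1/b_1) + G(1/b_1) (t - 1/b_1), and the two integrals of the
    statement are (1 - 1/b_1) G(1/b_1) and H(1/b_1); substituting gives the
    formulas. *)

(** * Free direct summands *)

Section Kernel.
Context (A : comNzRingType) (M V : lmodType A) (h : {linear M -> V}).

Definition ker_pred : {pred M} := fun x => h x == 0.

Lemma ker_submod : submod_closed ker_pred.
Proof.
split=> [|a x y]; rewrite !unfold_in ?linear0 // linearP => /eqP-> /eqP->.
by rewrite scaler0 addr0.
Qed.

HB.instance Definition _ := GRing.isSubmodClosed.Build A M ker_pred ker_submod.

Record ker := Ker { ker_val :> M; _ : ker_val \in ker_pred }.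
HB.instance Definition _ := [isSub for ker_val].
HB.instance Definition _ := [Choice of ker by <:].
HB.instance Definition _ := [SubChoice_isSubLmodule of ker by <:].

End Kernel.

Section FreeRank.
Context (A : comNzRingType) (M : lmodType A).

(** The dual system splits the map given by the [psi i]; the complement of the
    free module is its kernel. *)
Lemma dual_system_free_summand (N : nat) (g : 'I_N -> M)
    (psi : 'I_N -> {linear M -> A^o}) :
  (forall i j, psi i (g j) = (i == j)%:R) -> has_free_summand M N.
Proof.
move=> psig.
pose h (x : M) : 'rV[A]_N := \row_i psi i x.
have h_lin : linear h by move=> a x y; apply/rowP => i; rewrite !mxE linearP.
pose hl : {linear M -> 'rV[A]_N} :=
  HB.pack h (GRing.isLinear.Build _ _ _ _ h h_lin).
pose s (v : 'rV[A]_N) : M := \sum_i v 0 i *: g i.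
have hs v : h (s v) = v.
  apply/rowP => i; rewrite mxE /s linear_sum (bigD1 i) //= linearZ /= psig eqxx.
  rewrite big1 => [|j ji]; last by rewrite linearZ /= psig eq_sym (negPf ji) scaler0.
  by rewrite addr0; exact: mulr1.
have r_ker x : x - s (h x) \in ker_pred hl.
  by rewrite unfold_in linearB; apply/eqP; rewrite -[hl (s _)]/(h _) hs subrr.
pose f x : ('rV[A]_N * ker hl)%type := (h x, Ker (r_ker x)).
have f_lin : linear f.
  move=> a x y; rewrite /f; apply: injective_projections => /=.
    exact: h_lin.
  apply: val_inj; rewrite [RHS]linearP /=.
  have -> : s (h (a *: x + y)) = a *: s (h x) + s (h y).
    rewrite h_lin /s scaler_sumr -big_split; apply: eq_bigr => i _.
    by rewrite !mxE scalerDl scalerA.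
  by rewrite opprD addrACA scalerBr.
pose fl : {linear M -> ('rV[A]_N * ker hl)%type} :=
  HB.pack f (GRing.isLinear.Build _ _ _ _ f f_lin).
exists (ker hl), fl, (fun vz => s vz.1 + val vz.2) => [x|[v z]].
  by rewrite /= addrC subrK.
have hz : h (val z) = 0 by apply/eqP; case: z.
have hx : h (s v + val z) = v by rewrite -[LHS]/(hl _) linearD /= hs hz addr0.
apply: injective_projections => /=; first exact: hx.
by apply: val_inj; rewrite /= hx addrC addKr.
Qed.

(** If A^c is a summand, evaluating its c coordinate forms on its c basis
    vectors gives the identity matrix.  When the residues of the values of all
    linear forms are determined by those on N elements, this identity matrix
    over K factors through K^N. *)
Lemma free_summand_rank_le (K : fieldType) (res : {rmorphism A -> K}) (N : nat)
    (g : 'I_N -> M) (c : nat) :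
  (forall y, exists l : 'I_N -> K, forall phi : {linear M -> A^o},
    res (phi y) = \sum_j l j * res (phi (g j))) ->
  has_free_summand M c -> (c <= N)%N.
Proof.
move=> gen [V [f [f' fK f'K]]].
pose phi (i : 'I_c) (x : M) : A^o := (f x).1 0 i.
have phi_lin i : linear (phi i).
  by move=> a x y; rewrite /phi linearP /= !mxE.
pose phil i : {linear M -> A^o} :=
  HB.pack (phi i) (GRing.isLinear.Build _ _ _ _ (phi i) (phi_lin i)).
pose y (i : 'I_c) := f' (delta_mx 0 i, 0).
have [l lP] := choice (fun i => gen (y i)).
pose L : 'M[K]_(c, N) := \matrix_(i, j) l i j.
pose G : 'M[K]_(N, c) := \matrix_(j, i) res (phil i (g j)).
have LG : L *m G = 1%:M.
  apply/matrixP => i i'; rewrite !mxE.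
  transitivity (res (phil i' (y i))).
    by rewrite lP; apply: eq_bigr => j _; rewrite !mxE.
  rewrite /= /phi /y f'K !mxE eqxx /= rmorph_nat; by rewrite eq_sym.
have := mxrankM_maxl L G; rewrite LG mxrank1 => /leq_trans; apply.
exact: rank_leq_col.
Qed.

End FreeRank.

(** * Localization and q-th root linear maps *)

(** [to_local : B -> L] stands for the localization of B at the kernel of
    [cst : B -> K]: a unit is a fraction of elements not killed by [cst]. *)
Section ResidueMap.
Context (B L : comNzRingType) (K : fieldType).
Context (to_local : {rmorphism B -> L}) (cst : {rmorphism B -> K}).
Hypothesis to_local_inj : injective to_local.
Hypothesis to_local_unit : forall s, cst s != 0 -> exists t, to_local s * t = 1.
Hypothesis local_fraction : forall y, exists f s, cst s != 0 /\ y * to_local s = to_local f.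

Lemma residue_map : exists res : {rmorphism L -> K}, forall f, res (to_local f) = cst f.
Proof.
have ex y : exists z, forall f s, cst s != 0 -> y * to_local s = to_local f ->
    z * cst s = cst f.
  have [f0 [s0 [s0n y0]]] := local_fraction y.
  exists (cst f0 / cst s0) => f s sn yf.
  rewrite mulrAC; apply: (mulIf s0n); rewrite mulfVK // -!rmorphM; congr (cst _).
  by apply: to_local_inj; rewrite !rmorphM -y0 -yf mulrAC.
have [r rE] := choice ex.
have rB : zmod_morphism r.
  move=> y z; have [f [s [sn yf]]] := local_fraction y; have [g [t [tn zg]]] := local_fraction z.
  have stn : cst (s * t) != 0 by rewrite rmorphM mulf_neq0.
  apply: (mulIf stn); rewrite (rE (y - z) (f * t - g * s)) //.
    rewrite rmorphB !rmorphM -(rE _ _ _ sn yf) -(rE _ _ _ tn zg); ring.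
  by rewrite rmorphB !rmorphM -yf -zg; ring.
have rM : monoid_morphism r.
  split=> [|y z].
    have c1 : cst 1 != 0 by rewrite rmorph1 oner_eq0.
    by have := rE 1 1 1 c1; rewrite !rmorph1 !mulr1; apply.
  have [f [s [sn yf]]] := local_fraction y; have [g [t [tn zg]]] := local_fraction z.
  have stn : cst (s * t) != 0 by rewrite rmorphM mulf_neq0.
  apply: (mulIf stn); rewrite (rE (y * z) (f * g)) //.
    rewrite !rmorphM -(rE _ _ _ sn yf) -(rE _ _ _ tn zg); ring.
  by rewrite !rmorphM -yf -zg; ring.
pose res : {rmorphism L -> K} :=
  HB.pack r (GRing.isZmodMorphism.Build _ _ r rB)
    (GRing.isMonoidMorphism.Build _ _ r rM).
exists res => f; have c1 : cst 1 != 0 by rewrite rmorph1 oner_eq0.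
by have := rE (to_local f) f 1 c1; rewrite !rmorph1 !mulr1; apply.
Qed.

End ResidueMap.

Section FrobeniusLocalization.
Context (B L : comNzRingType) (K : fieldType) (p : nat) (chL : p \in [pchar L]).
Context (e : nat) (to_local : {rmorphism B -> L}) (cst : {rmorphism B -> K}).
Context (res : {rmorphism L -> K}).
Hypothesis to_local_inj : injective to_local.
Hypothesis to_local_unit : forall s, cst s != 0 -> exists t, to_local s * t = 1.
Hypothesis local_fraction : forall y, exists f s, cst s != 0 /\ y * to_local s = to_local f.
Hypothesis resE : forall f, res (to_local f) = cst f.

Local Notation q := (p ^ e)%N.
Local Notation M := (Frobenius_push chL e).

Lemma q_gt0 : (0 < q)%N.
Proof. by rewrite expn_gt0 prime_gt0 // (pcharf_prime chL). Qed.

Lemma push_scaleE (a : L) (x : M) : a *: x = a ^+ q * (x : L) :> L.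
Proof. by []. Qed.

(** f / s = f s^(q-1) / s^q: the q-th power in the denominator is a scalar of
    F^e_* L, so every element of F^e_* L is a multiple of an element of B. *)
Lemma local_fraction_q y : exists g s, cst s != 0 /\ y * to_local s ^+ q = to_local g.
Proof.
have [f [s [s0 ys]]] := local_fraction y; exists (f * s ^+ q.-1), s; split=> //.
by rewrite -(prednK q_gt0) exprS mulrA ys -rmorphXn -rmorphM.
Qed.

Lemma to_local_cancel s x y : cst s != 0 -> x * to_local s = y * to_local s -> x = y.
Proof.
move=> /to_local_unit[t st] xy; rewrite -[x]mulr1 -[y]mulr1 -st !mulrA.
by rewrite xy.
Qed.

(** A q-th root linear map extends to the localization by
    g / s^q |-> phi g / s. *)
Lemma Frobenius_extension (phi : B -> B) :
  {morph phi : x y / x + y} -> (forall g f, phi (g ^+ q * f) = g * phi f) ->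
  exists Phi : {linear M -> L^o}, forall f, Phi (to_local f) = to_local (phi f).
Proof.
move=> phiD phiM.
have ex y : exists z, forall g s, cst s != 0 -> y * to_local s ^+ q = to_local g ->
    z * to_local s = to_local (phi g).
  have [g0 [s0 [s00 yg0]]] := local_fraction_q y; have [t st] := to_local_unit s00.
  exists (to_local (phi g0) * t) => g s sn0 yg.
  apply: (to_local_cancel s00); rewrite mulrAC -[_ * t * _]mulrA [t * _]mulrC st mulr1.
  rewrite -!rmorphM [_ * s]mulrC -phiM [_ * s0]mulrC -phiM; congr (to_local (phi _)).
  by apply: to_local_inj; rewrite !rmorphM !rmorphXn -yg0 -yg; ring.
have [Phi PhiE] := choice ex.
have PhiD y y' : Phi (y + y') = Phi y + Phi y'.
  have [g [s [sn0 yg]]] := local_fraction_q y; have [g' [s' [s'n0 yg']]] := local_fraction_q y'.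
  have ssn0 : cst (s * s') != 0 by rewrite rmorphM mulf_neq0.
  apply: (to_local_cancel ssn0).
  rewrite (PhiE (y + y') (s' ^+ q * g + s ^+ q * g')) //; last first.
    by rewrite rmorphD !rmorphM !rmorphXn -yg -yg' exprMn; ring.
  rewrite phiD !phiM rmorphD !rmorphM -(PhiE _ _ _ sn0 yg).
  by rewrite -(PhiE _ _ _ s'n0 yg'); ring.
have PhiZ x y : Phi (x ^+ q * y) = x * Phi y.
  have [g [s [sn0 yg]]] := local_fraction_q y; have [f [r [rn0 xf]]] := local_fraction x.
  have rsn0 : cst (r * s) != 0 by rewrite rmorphM mulf_neq0.
  apply: (to_local_cancel rsn0); rewrite (PhiE _ (f ^+ q * g)) //; last first.
    by rewrite !rmorphM !rmorphXn -yg -xf !exprMn; ring.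
  by rewrite phiM !rmorphM -(PhiE _ _ _ sn0 yg) -xf; ring.
pose PhiM (x : M) : L^o := Phi x.
have Phi_lin : linear PhiM by move=> x y z; rewrite /PhiM PhiD; congr (_ + _); exact: PhiZ.
pose PhiL : {linear M -> L^o} :=
  HB.pack PhiM (GRing.isLinear.Build _ _ _ _ PhiM Phi_lin).
exists PhiL => f.
have c1 : cst 1 != 0 by rewrite rmorph1 oner_eq0.
by have := PhiE (to_local f) f 1 c1; rewrite rmorph1 expr1n !mulr1; apply.
Qed.

(** Linearity turns h^q z = g^q z' into h Phi(z) = g Phi(z'); if Phi(z) were a
    unit, g would divide h in the local ring. *)
Lemma Frobenius_nonunit (z z' h g : B) (Phi : {linear M -> L^o}) :
  h ^+ q * z = g ^+ q * z' -> (forall f s, s * h = g * f -> cst s = 0) ->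
  res (Phi (to_local z)) = 0.
Proof.
move=> hz nodiv.
have e1 : to_local h * Phi (to_local z) = to_local g * Phi (to_local z').
  rewrite -[to_local h * _]/(to_local h *: Phi _) -linearZ push_scaleE.
  rewrite -[to_local g * _]/(to_local g *: Phi _) -linearZ push_scaleE.
  by rewrite -!rmorphXn -!rmorphM hz.
have [f1 [s1 [s1n0 e2]]] := local_fraction (Phi (to_local z)).
have [f2 [s2 [s2n0 e3]]] := local_fraction (Phi (to_local z')).
have : cst (s2 * f1) = 0.
  apply: (nodiv (s1 * f2)); apply: to_local_inj; rewrite !rmorphM -e2 -e3.
  have := congr1 ( *%R (to_local s1 * to_local s2)) e1 => /= e4.
  transitivity (to_local s1 * to_local s2 * (to_local h * Phi (to_local z))); first by ring.
  by rewrite e4; ring.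
rewrite rmorphM => /eqP; rewrite mulf_eq0 (negPf s2n0) /= => /eqP.
by rewrite -!resE -e2 rmorphM resE => /eqP; rewrite mulf_eq0 (negPf s1n0) orbF => /eqP.
Qed.

Section Spanned.
Context (N : nat) (gen : 'I_N -> B).

(** Weaker than spanning: an element that every linear form sends into the
    maximal ideal is spanned in this sense.  A bound on the free rank therefore
    needs only the other generators. *)
Definition residually_spanned (y : L) : Prop :=
  exists l : 'I_N -> K, forall Phi : {linear M -> L^o},
    res (Phi y) = \sum_j l j * res (Phi (to_local (gen j))).

Lemma spannedD y y' :
  residually_spanned y -> residually_spanned y' -> residually_spanned (y + y').
Proof.
move=> [l lP] [l' lP']; exists (fun j => l j + l' j) => Phi.
rewrite [Phi _](linearD Phi (y : M) y') rmorphD lP lP' -big_split.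
by apply: eq_bigr => j _; rewrite mulrDl.
Qed.

Lemma spannedZ a y : residually_spanned y -> residually_spanned (a ^+ q * y).
Proof.
move=> [l lP]; exists (fun j => res a * l j) => Phi.
have -> : Phi (a ^+ q * y) = a * Phi y by exact: (linearZZ Phi a (y : M)).
rewrite rmorphM lP mulr_sumr.
by apply: eq_bigr => j _; rewrite mulrA.
Qed.

Lemma spanned_gen j : residually_spanned (to_local (gen j)).
Proof.
exists (fun i => (i == j)%:R) => Phi; rewrite (bigD1 j) //= eqxx mul1r big1 ?addr0 //.
by move=> i /negPf->; rewrite mul0r.
Qed.

Lemma spanned0 y : (forall Phi : {linear M -> L^o}, res (Phi y) = 0) -> residually_spanned y.
Proof. by move=> y0; exists (fun=> 0) => Phi; rewrite y0 big1 // => j _; rewrite mul0r. Qed.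

Lemma spanned_all :
  (forall f, residually_spanned (to_local f)) -> forall y, residually_spanned y.
Proof.
move=> spB y; have [g [s [sn0 yg]]] := local_fraction_q y; have [t st] := to_local_unit sn0.
suff -> : y = t ^+ q * to_local g by apply: spannedZ.
by rewrite -yg mulrC -mulrA -exprMn st expr1n mulr1.
Qed.

End Spanned.
End FrobeniusLocalization.

(** * Bases of a field over its q-th powers *)

Section FrobeniusBasis.
Context (K : fieldType) (p : nat) (chK : p \in [pchar K]).

Lemma pchar_expD (A : comNzRingType) (chA : p \in [pchar A]) e (x y : A) :
  (x + y) ^+ (p ^ e) = x ^+ (p ^ e) + y ^+ (p ^ e).
Proof.
by rewrite exprDn_pchar // pnatX (eq_pnat _ (pcharf_eq chA)) pnat_id ?(pcharf_prime chA).
Qed.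

Lemma pchar_exp_inj : injective (fun x : K => x ^+ p).
Proof. exact: (fmorph_inj (pFrobenius_aut chK)). Qed.

Lemma is_frobenius_degree_gt0 D : is_frobenius_degree K p D -> (0 < D)%N.
Proof.
case: D => // -[w /(_ 1)[c [[_ /eqP]]]].
by rewrite big_ord0 oner_eq0.
Qed.

(** Uniqueness of the coordinates, together with injectivity of the Frobenius
    map, makes the p-th roots of the coordinates additive. *)
Lemma Frobenius_basis1 D : is_frobenius_degree K p D ->
  exists (w : 'I_D -> K) (co : 'I_D -> {additive K -> K}),
    [/\ forall i y x, co i (y ^+ p * x) = y * co i x,
        forall i j, co i (w j) = (i == j)%:R
      & forall x, x = \sum_i co i x ^+ p * w i].
Proof.
move=> [w wP]; exists w.
have ex x : exists c : 'I_D -> K, x = \sum_i c i ^+ p * w i.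
  have [c [[cp xE] _]] := wP x; have [r rE] := choice cp.
  by exists r; rewrite {1}xE; apply: eq_bigr => i _; rewrite rE.
have uniq_co (c c' : 'I_D -> K) :
    \sum_i c i ^+ p * w i = \sum_i c' i ^+ p * w i -> c =1 c'.
  move=> ecc'; have [c0 [_ c0U]] := wP (\sum_i c i ^+ p * w i).
  have h (d : 'I_D -> K) : \sum_i c i ^+ p * w i = \sum_i d i ^+ p * w i ->
      c0 = [ffun i => d i ^+ p].
    move=> ed; apply: c0U; split=> [i|]; first by rewrite ffunE; exists (d i).
    by rewrite ed; apply: eq_bigr => i _; rewrite ffunE.
  move=> i; apply: pchar_exp_inj => /=.
  have := h _ erefl; rewrite (h _ ecc') => /ffunP/(_ i).
  by rewrite !ffunE => ->.
have [co coE] := choice ex.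
have coB x y i : co (x - y) i = co x i - co y i.
  apply: (uniq_co _ (fun i => co x i - co y i)); rewrite -coE {1}(coE x) {1}(coE y) -sumrB.
  apply: eq_bigr => j _; rewrite -mulrBl; congr (_ * _).
  by rewrite -[LHS](rmorphB (pFrobenius_aut chK)).
pose coi i x := co x i.
have coi_add i : {morph coi i : x y / x - y} by move=> x y; exact: coB.
pose coA i : {additive K -> K} :=
  HB.pack (coi i) (GRing.isZmodMorphism.Build _ _ (coi i) (coi_add i)).
exists coA; split=> /=.
- move=> i y x; apply: (uniq_co _ (fun i => y * co x i)); rewrite -coE {1}(coE x) mulr_sumr.
  by apply: eq_bigr => j _; rewrite exprMn mulrA.
- move=> i j; apply: (uniq_co _ (fun i => (i == j)%:R)); rewrite -coE.
  rewrite (bigD1 j) //= eqxx expr1n mul1r big1 ?addr0 // => l /negPf->.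
  by rewrite expr0n gtn_eqF ?mul0r // prime_gt0 // (pcharf_prime chK).
- exact: coE.
Qed.

(** The products w_t^p w_i of a basis over K^(p^e) and one over K^p form a basis
    over K^(p^(e+1)).  The numbers co t x are the q-th roots of the coordinates
    of x; unlike the coordinates themselves they are q-th root linear in x. *)
Lemma Frobenius_basis D e : is_frobenius_degree K p D ->
  exists (T : finType) (w : T -> K) (co : T -> {additive K -> K}),
    [/\ #|T| = (D ^ e)%N,
        forall t y x, co t (y ^+ (p ^ e) * x) = y * co t x,
        forall t t', co t (w t') = (t == t')%:R
      & forall x, x = \sum_t co t x ^+ (p ^ e) * w t].
Proof.
move=> /Frobenius_basis1[w1 [co1 [co1M co1w co1E]]].
elim: e => [|e [T [w [co [cardT coM cow coE]]]]].
  exists unit, (fun=> 1), (fun=> idfun); split=> //.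
  - by rewrite card_unit.
  - by move=> x; rewrite (big_pred1 tt) ?mulr1 //; case.
exists ('I_D * T)%type, (fun it => w it.2 ^+ p * w1 it.1).
exists (fun it => co it.2 \o co1 it.1); split=> /=.
- by rewrite card_prod card_ord cardT expnS.
- by move=> [i t] y x /=; rewrite expnS mulnC exprM co1M coM.
- move=> [i t] [j t'] /=; rewrite co1M co1w xpair_eqE mulr_natr.
  by case: (i == j) => /=; rewrite ?mulr1n ?cow // mulr0n raddf0.
- move=> x; rewrite {1}(co1E x) -(pair_bigA _ (fun i t => co t (co1 i x) ^+ (p ^ e.+1) * (w t ^+ p * w1 i))) /=.
  apply: eq_bigr => i _; rewrite {1}(coE (co1 i x)).
  rewrite -[(\sum_t _) ^+ p]/(pFrobenius_aut chK _) rmorph_sum mulr_suml.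
  by apply: eq_bigr => t _; rewrite rmorphM /= !pFrobenius_autE -exprM -expnSr mulrA.
Qed.

End FrobeniusBasis.

(** * Monomials of the intersection algebra and q-th root maps *)

Section NatFacts.
Local Open Scope nat_scope.

Lemma leq_addM (q x m m' : nat) : m <= m' -> m * q <= x + m' * q.
Proof. by move=> mm; rewrite (leq_trans _ (leq_addl _ _)) // leq_mul2r mm orbT. Qed.

Lemma addM_subM (q x m m' : nat) : m <= m' -> x + m' * q - m * q = x + (m' - m) * q.
Proof. by move=> mm; rewrite mulnBl addnBA // leq_mul2r mm orbT. Qed.

Lemma leq_of_addM (q x m m' : nat) : x < q -> m * q <= x + m' * q -> m <= m'.
Proof.
move=> xq h; rewrite leqNgt; apply/negP => mm.
have : m'.+1 * q <= m * q by rewrite leq_mul2r mm orbT.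
by rewrite mulSn => h'; have := leq_trans h' h; rewrite leq_add2r leqNgt xq.
Qed.

(** A facet form that is < q at w and >= 0 at w + q y is > -q at q y, hence >= 0
    at y by integrality. *)
Lemma cone_descent (q x y t u v : nat) :
  (x + y * q) * t <= u + v * q -> u < q + x * t -> y * t <= v.
Proof.
move=> h1 h2; rewrite leqNgt; apply/negP => h3.
have h4 : v.+1 * q <= y * t * q by rewrite leq_mul2r h3 orbT.
move: h1; rewrite leqNgt => /negP; apply.
by rewrite mulnDl mulnAC; move: h4; rewrite mulSn; lia.
Qed.

(** The same when y = c' - c is not yet known to be nonnegative, with truncated
    subtraction. *)
Lemma cone_descent_le (q x y t u c c' : nat) :
  (x + y * q) * t <= u + c' * q - c * q -> u < q + x * t -> c * q <= u + c' * q -> c <= c'.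
Proof.
move=> h1 h2 h3; rewrite leqNgt; apply/negP => h4.
have h5 : c'.+1 * q <= c * q by rewrite leq_mul2r h4 orbT.
by move: h1 h5; rewrite mulnDl mulSn; lia.
Qed.

End NatFacts.

Section Sieve.
Import mpoly.

Lemma mcoeffXM (R : comNzRingType) n (m m' : 'X_{1..n}) (f : {mpoly R[n]}) :
  ('X_[m] * f)@_m' = if (m <= m')%MM then f@_(m' - m)%MM else 0.
Proof.
case: ifP => mm'.
  by rewrite -[in LHS](submK mm') addmC mulrC mcoeffMX.
apply/memN_msupp_eq0; rewrite mulrC (perm_mem (msuppMX _ _)).
apply/negP => /mapP[d _ md]; move: mm'.
suff -> : (m <= m')%MM by [].
by apply/mnm_lepP => i; rewrite md mnmDE leq_addr.
Qed.

Context (n q : nat) (R1 R2 : comNzRingType) (w : 'X_{1..n}).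
Context (kappa : {additive R1 -> R2}).

(** Stated for one level of variables and any additive map on the coefficients,
    so that it can be applied to x_1, ..., x_n and then to u, v. *)
Definition sieve (f : {mpoly R1[n]}) : {mpoly R2[n]} :=
  \sum_(y : 'X_{1..n < msize f}) kappa f@_(w + y *+ q) *: 'X_[y].

Hypothesis q_gt0 : (0 < q)%N.

Lemma mcoeff_sieve f y : (sieve f)@_y = kappa f@_(w + y *+ q).
Proof.
have [ylt|yge] := ltnP (mdeg y) (msize f).
  exact: (mcoeff_mpoly (fun z => kappa f@_(w + z *+ q))).
rewrite [in RHS]memN_msupp_eq0 ?raddf0; last first.
  apply: msize_mdeg_ge; apply: leq_trans yge _.
  by rewrite mdegD mdegMn; nia.
rewrite raddf_sum big1 // => z _ /=; rewrite mcoeffZ mcoeffX.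
case: eqVneq => [zy|_]; last by rewrite mulr0.
by have := bmdeg z; rewrite zy ltnNge yge.
Qed.

Lemma sieve_zmod_morphism : {morph sieve : f g / f - g}.
Proof.
by move=> f g; apply/mpolyP => y; rewrite mcoeffB !mcoeff_sieve mcoeffB raddfB.
Qed.

Definition sieveA : {additive {mpoly R1[n]} -> {mpoly R2[n]}} :=
  HB.pack sieve (GRing.isZmodMorphism.Build _ _ sieve sieve_zmod_morphism).

End Sieve.

Section IntersectionAlgebra.
Import mpoly.
Context (K : fieldType) (n : nat) (a b : 'I_n -> nat).
Local Notation S := {mpoly {mpoly K[n]}[2]}.
Local Notation B := (intersection_algebra K a b).
Local Notation mono := (@uvx_monomial K n).

(** The exponent vectors of the generators of the two ideals, indexed like the
    variables u and v, so that the facets for I and for J are treated alike. *)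
Definition gen_exp (k : 'I_2) : 'I_n -> nat := if k == ord0 then a else b.

Definition in_cone (m : 'X_{1..2}) (c : 'X_{1..n}) : Prop :=
  forall k i, (m k * gen_exp k i <= c i)%N.

Lemma ord2P (k : 'I_2) : k = ord0 \/ k = ord_max.
Proof. by case: k => -[|[|//]] k2; [left|right]; apply: val_inj. Qed.

Lemma xmon_dvdP (d : 'I_n -> nat) (f : {mpoly K[n]}) :
  (exists g, f = g * xmon K d) <->
  (forall c, f@_c != 0 -> forall i, (d i <= c i)%N).
Proof.
split=> [[g ->] c|fd].
  rewrite mulrC mcoeffXM; case: ifP => [/mnm_lepP dc _ i|_]; last by rewrite eqxx.
  by have := dc i; rewrite mnmE.
exists (\sum_(c <- msupp f) f@_c *: 'X_[c - [multinom d i | i < n]]).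
rewrite {1}[f]mpolyE mulr_suml big_seq [RHS]big_seq; apply: eq_bigr => c cf.
rewrite -scalerAl -mpolyXD submK //; apply/mnm_lepP => i; rewrite mnmE.
by apply: fd; rewrite -mcoeff_msupp.
Qed.

Lemma in_intersection (f : S) :
  (f \in intersection_pred a b) <-> (forall m c, f@_m@_c != 0 -> in_cone m c).
Proof.
split=> [/intersection_predP h m c fmc k i|h].
  have [/xmon_dvdP h1 /xmon_dvdP h2] := h m.
  case: (ord2P k) => ->; rewrite /gen_exp /=; [exact: h1|exact: h2].
apply/intersection_predP => m; split; apply/xmon_dvdP => c fmc i.
  exact: (h m c fmc ord0).
exact: (h m c fmc ord_max).
Qed.

Lemma mcoeff_mono c m m' c' :
  (mono c m)@_m'@_c' = ((m == m') && (c == c'))%:R.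
Proof.
rewrite mcoeffZ mcoeffX; case: (m == m') => /=; last by rewrite mulr0 mcoeff0.
by rewrite mulr1 mcoeffX.
Qed.

Lemma monoD c m c' m' : mono (c + c') (m + m') = mono c m * mono c' m'.
Proof. by rewrite /uvx_monomial !mpolyXD -scalerAl -scalerAr scalerA. Qed.

Lemma monoX c m r : mono c m ^+ r = mono (c *+ r) (m *+ r).
Proof. by rewrite /uvx_monomial exprZn !mpolyXn. Qed.

Lemma mcoeff_termM (z : K) c m (f : S) m' c' :
  (z%:MP *: mono c m * f)@_m'@_c' =
  z * (if (m <= m')%MM && (c <= c')%MM then f@_(m' - m)@_(c' - c) else 0).
Proof.
rewrite -scalerAl mcoeffZ mcoeffCM /uvx_monomial -scalerAl mcoeffZ.
congr (z * _); rewrite mcoeffXM mcoeffXM; case: (m <= m')%MM => //=.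
by rewrite mcoeff0 if_same.
Qed.

Lemma mpoly2_ind (P : S -> Prop) :
  P 0 -> (forall f g, P f -> P g -> P (f + g)) ->
  (forall z c m, P (z%:MP *: mono c m)) -> forall f, P f.
Proof.
move=> P0 PD Pt.
have Pm m g : P (g *: 'X_[m]).
  elim/mpolyind: g => [|z c g _ _ Pg]; first by rewrite scale0r.
  rewrite scalerDl; apply: PD => //.
  by have := Pt z c m; rewrite /uvx_monomial scalerA mul_mpolyC.
by elim/mpolyind => // g m f _ _; apply: PD.
Qed.

(** Monomials of B are used only through their values in the polynomial ring,
    so they are introduced by specification; outside the cone the value is
    arbitrary. *)
Fact term_spec : {t : K -> 'X_{1..2} -> 'X_{1..n} -> B |
  forall z m c, in_cone m c -> val (t z m c) = z%:MP *: mono c m}.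
Proof.
exists (fun z m c => insubd 0 (z%:MP *: mono c m)) => z m c mc.
rewrite insubdK //; apply/in_intersection => m' c'.
rewrite mcoeffZ mcoeffCM mcoeff_mono.
by case: andP => [[/eqP<- /eqP<-] //|_]; rewrite mulr0 eqxx.
Qed.

Definition term : K -> 'X_{1..2} -> 'X_{1..n} -> B := sval term_spec.

Lemma val_term z m c : in_cone m c -> val (term z m c) = z%:MP *: mono c m.
Proof. exact: (svalP term_spec). Qed.

Lemma intersection_ind (P : B -> Prop) :
  P 0 -> (forall f g, P f -> P g -> P (f + g)) ->
  (forall z m c, in_cone m c -> P (term z m c)) -> forall f, P f.
Proof.
move=> P0 PD Pt f.
pose s := [seq (m, c) | m <- msupp (val f), c <- msupp (val f)@_m].
have -> : f = \sum_(t <- s) term (val f)@_t.1@_t.2 t.1 t.2.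
  apply: val_inj; rewrite raddf_sum big_allpairs_dep [LHS]mpolyE big_seq [RHS]big_seq.
  apply: eq_bigr => m mf /=.
  rewrite {1}(mpolyE (val f)@_m) scaler_suml big_seq [RHS]big_seq; apply: eq_bigr => c cf.
  rewrite val_term; first by rewrite /uvx_monomial scalerA mul_mpolyC.
  have /in_intersection h := valP f; apply: h.
  by rewrite -mcoeff_msupp.
rewrite big_seq; elim/big_ind: _ => // t /allpairsPdep[m [c [mf cf ->]]] /=.
apply: Pt; have /in_intersection h := valP f; apply: h.
by rewrite -mcoeff_msupp.
Qed.

Section Sieving.
Context (q : nat) (q_gt0 : (0 < q)%N) (mw : 'X_{1..2}) (cw : 'X_{1..n}).

(** The exponents at which every facet form takes a value in [0, q). *)
Definition splitting_exponent (m : 'X_{1..2}) (c : 'X_{1..n}) : Prop :=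
  [/\ in_cone m c, forall k, (m k < q)%N & forall k i, (c i < q + m k * gen_exp k i)%N].

Hypothesis w_splits : splitting_exponent mw cw.
Context (co : {additive K -> K}).
Hypothesis coM : forall y x, co (y ^+ q * x) = y * co x.

Definition extract : {additive S -> S} := sieveA mw (sieveA cw co q_gt0) q_gt0.

Lemma mcoeff_extract f m c :
  (extract f)@_m@_c = co f@_(mw + m *+ q)@_(cw + c *+ q).
Proof. by rewrite /extract /= !mcoeff_sieve. Qed.

Lemma extract_intersection f :
  f \in intersection_pred a b -> extract f \in intersection_pred a b.
Proof.
move=> /in_intersection fB; apply/in_intersection => m c; rewrite mcoeff_extract => fmc k i.
have /fB/(_ k i) : f@_(mw + m *+ q)@_(cw + c *+ q) != 0.
  by apply: contraNneq fmc => ->; rewrite raddf0.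
case: w_splits => _ _ /(_ k i) wi.
by rewrite !mnmDE !mulmnE => /cone_descent; apply.
Qed.

Hypothesis qD : {morph (fun g : S => g ^+ q) : x y / x + y}.

(** For g = z t^d with t^d a monomial, both sides select the coefficients of f
    at w + q (y - d).  On the left y - d may have negative entries; but if f has
    a nonzero coefficient there, every facet form is >= 0 at w + q (y - d) and
    < q at w, so y - d lies in the cone and has no negative entry. *)
Lemma extract_semilinear g f :
  f \in intersection_pred a b -> extract (g ^+ q * f) = g * extract f.
Proof.
move=> /in_intersection fB; elim/mpoly2_ind: g => [|g g' Pg Pg'|z c m].
- by rewrite expr0n gtn_eqF // !mul0r raddf0.
- by rewrite mulrDl -Pg -Pg' -[RHS]raddfD -mulrDl -(qD g g').
rewrite exprZn monoX -rmorphXn; apply/mpolyP => m'; apply/mpolyP => c'.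
rewrite mcoeff_extract !mcoeff_termM coM mcoeff_extract; congr (z * _).
case: (boolP (_ && _)) => [/andP[/mnm_lepP mm /mnm_lepP cc]|Nle]; last first.
  rewrite raddf0; case: ifP => // /andP[/mnm_lepP mm /mnm_lepP cc].
  by case/negP: Nle; apply/andP; split; apply/mnm_lepP => i;
    rewrite mnmDE !mulmnE; apply: leq_addM.
have lemm k : (m k <= m' k)%N.
  by have := mm k; rewrite mnmDE !mulmnE; apply: leq_of_addM; case: w_splits.
have mE : (mw + m' *+ q - m *+ q = mw + (m' - m) *+ q)%MM.
  by apply/mnmP => i; rewrite !(mnmBE, mnmDE, mulmnE) addM_subM.
rewrite mE; case: ifP => [/andP[_ /mnm_lepP lecc]|Nle].
  congr (co (mcoeff _ _)).
  by apply/mnmP => i; rewrite !(mnmBE, mnmDE, mulmnE) addM_subM.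
have [->|/fB h] := eqVneq f@_(mw + (m' - m) *+ q)@_(cw + c' *+ q - c *+ q) 0.
  by rewrite raddf0.
case/negP: (negbT Nle); apply/andP; split; apply/mnm_lepP => // i.
case: w_splits => _ _ /(_ ord0 i) w1; have := h ord0 i; have := cc i.
by rewrite !(mnmBE, mnmDE, mulmnE) => ? /cone_descent_le; apply.
Qed.

End Sieving.

End IntersectionAlgebra.

(** * The local ring and the splitting monomials *)

Section LocalRing.
Import mpoly.
Context (K : fieldType) (n : nat) (a b : 'I_n -> nat).
Local Notation S := {mpoly {mpoly K[n]}[2]}.
Local Notation B := (intersection_algebra K a b).
Local Notation L := (local_algebra K a b).
Local Notation "x %:F" := (FracField.tofrac x).

Definition constant_coeff : {rmorphism B -> K} :=
  mcoeff 0%MM \o (mcoeff 0%MM \o val).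

Lemma constant_coeffE (f : B) : constant_coeff f = (val f)@_0%MM@_0%MM.
Proof. by []. Qed.

Lemma constant_coeff_neq0 (s : B) : constant_coeff s != 0 -> ~ max_ideal s.
Proof. by move=> s0 /max_idealP s0'; case/eqP: s0. Qed.

Lemma constant_coeff_val_neq0 (s : B) : constant_coeff s != 0 -> val s != 0.
Proof. by apply: contraNneq; rewrite constant_coeffE => ->; rewrite !mcoeff0. Qed.

Lemma frac_in_local (f s : B) : constant_coeff s != 0 ->
  (val f)%:F / (val s)%:F \in local_pred a b.
Proof. by move=> s0; apply/asboolP; exists f, s; split=> //; exact: constant_coeff_neq0. Qed.

Lemma to_local_proof (f : B) : (val f)%:F \in local_pred a b.
Proof.
have c1 : constant_coeff 1 != 0 by rewrite rmorph1 oner_eq0.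
by have := frac_in_local f c1; rewrite !rmorph1 divr1.
Qed.

Definition to_local_fun (f : B) : L := LocalAlgebra (to_local_proof f).

Lemma ia_valM (f g : B) : val (f * g) = val f * val g :> S.
Proof. exact: (rmorphM (val : {rmorphism B -> S})). Qed.

Lemma ia_valX (f : B) r : val (f ^+ r) = val f ^+ r :> S.
Proof. exact: (rmorphXn (val : {rmorphism B -> S})). Qed.

Lemma la_valM (x y : L) : val (x * y) = val x * val y :> {fraction S}.
Proof. exact: (rmorphM (val : {rmorphism L -> {fraction S}})). Qed.

Lemma to_local_zmod_morphism : zmod_morphism to_local_fun.
Proof. by move=> f g; apply: val_inj; exact: (tofracB (val f) (val g)). Qed.

Lemma to_local_monoid_morphism : monoid_morphism to_local_fun.
Proof.
split=> [|f g]; apply: val_inj; first exact: tofrac1.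
transitivity ((val f)%:F * (val g)%:F); last by rewrite la_valM.
transitivity ((val f * val g)%:F); last by rewrite (tofracM (val f)).
by rewrite -ia_valM.
Qed.

Definition to_local : {rmorphism B -> L} :=
  HB.pack to_local_fun (GRing.isZmodMorphism.Build _ _ to_local_fun to_local_zmod_morphism)
    (GRing.isMonoidMorphism.Build _ _ to_local_fun to_local_monoid_morphism).

Lemma val_to_local f : val (to_local f) = (val f)%:F.
Proof. by []. Qed.

Lemma to_local_inj : injective to_local.
Proof.
by move=> f g /(congr1 val)/eqP; rewrite !val_to_local tofrac_eq => /eqP/val_inj.
Qed.

Lemma to_local_unit s : constant_coeff s != 0 -> exists t, to_local s * t = 1.
Proof.
move=> s0; have h := frac_in_local 1 s0; exists (LocalAlgebra h).
apply: val_inj; rewrite la_valM val_to_local /= tofrac1 mul1r divff //.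
by rewrite tofrac_eq0 constant_coeff_val_neq0.
Qed.

Lemma local_fraction y : exists f s, constant_coeff s != 0 /\ y * to_local s = to_local f.
Proof.
have /asboolP[f [s [ms yE]]] := valP y; exists f, s.
have s0 : constant_coeff s != 0 by apply/eqP => s0; apply: ms; apply/max_idealP.
split=> //; apply: val_inj; rewrite la_valM !val_to_local yE divfK //.
by rewrite tofrac_eq0 constant_coeff_val_neq0.
Qed.

End LocalRing.

Section SplittingExponents.
Import mpoly.
Context (n q : nat) (a b : 'I_n -> nat).
Local Open Scope nat_scope.

(** For given r and s the splitting exponents c_i fill an interval of length q
    shortened by this gap, starting at max(r a_i, s b_i); [splitting_code]
    records the offset of c_i from that end. *)
Definition facet_gap (r s : nat) (i : 'I_n) : nat :=
  maxn (r * a i) (s * b i) - minn (r * a i) (s * b i).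

Definition splitting_code : {pred 'I_q * 'I_q * {ffun 'I_n -> 'I_q}} :=
  fun g => [forall i, g.2 i + facet_gap g.1.1 g.1.2 i < q].

Definition code_m (g : 'I_q * 'I_q * {ffun 'I_n -> 'I_q}) : 'X_{1..2} :=
  [multinom (if k == ord0 then g.1.1 : nat else g.1.2 : nat) | k < 2].

Definition code_c (g : 'I_q * 'I_q * {ffun 'I_n -> 'I_q}) : 'X_{1..n} :=
  [multinom maxn (g.1.1 * a i) (g.1.2 * b i) + g.2 i | i < n].

Lemma code_splitting g : g \in splitting_code -> splitting_exponent a b q (code_m g) (code_c g).
Proof.
move=> /forallP gi; split=> [k i|k|k i].
- by rewrite !mnmE /gen_exp; case: eqP => _; lia.
- by rewrite !mnmE; case: eqP.
- have := gi i; rewrite /facet_gap !mnmE /gen_exp; case: eqP => _; lia.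
Qed.

Lemma splitting_coded m c : splitting_exponent a b q m c ->
  exists2 g, g \in splitting_code & code_m g = m /\ code_c g = c.
Proof.
move=> [mc mq cq].
have mc0 i : m ord0 * a i <= c i by have := mc ord0 i.
have mc1 i : m ord_max * b i <= c i by have := mc ord_max i.
have cq0 i : c i < q + m ord0 * a i by have := cq ord0 i.
have cq1 i : c i < q + m ord_max * b i by have := cq ord_max i.
have dq i : c i - maxn (m ord0 * a i) (m ord_max * b i) < q.
  by have := cq0 i; have := cq1 i; have := mc0 i; have := mc1 i; lia.
exists (Ordinal (mq ord0), Ordinal (mq ord_max), [ffun i => Ordinal (dq i)]).
  apply/forallP => i; rewrite ffunE /facet_gap /=.
  by have := cq0 i; have := cq1 i; have := mc0 i; have := mc1 i; lia.
split; apply/mnmP => i; rewrite !mnmE /=.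
  by case: (ord2P i) => ->.
rewrite ffunE /=.
by have := cq0 i; have := cq1 i; have := mc0 i; have := mc1 i; lia.
Qed.

Lemma code_inj g g' : code_m g = code_m g' -> code_c g = code_c g' -> g = g'.
Proof.
move: g g' => [[r s] d] [[r' s'] d'] /mnmP em /mnmP ec.
have er : r = r' by have := em ord0; rewrite !mnmE /= => /ord_inj.
have es : s = s' by have := em ord_max; rewrite !mnmE /= => /ord_inj.
rewrite -{}er -{}es in ec *; congr (_, _); apply/ffunP => i.
by have := ec i; rewrite !mnmE /= => /addnI/ord_inj.
Qed.

Lemma card_splitting_code :
  #|splitting_code| = \sum_(r < q) \sum_(s < q) \prod_(i < n) (q - facet_gap r s i).
Proof.
rewrite pair_bigA /= -sum1_card (eq_bigl (fun g => (fun=> true) g.1 && (g \in splitting_code))) //.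
rewrite -(pair_big_dep xpredT (fun rs d => (rs, d) \in splitting_code) (fun _ _ => 1)) /=.
apply: eq_bigr => -[r s] _ /=; rewrite sum1_card.
rewrite (_ : #|_| = #|family (fun i => [pred x : 'I_q | x + facet_gap r s i < q])|); last first.
  by apply: eq_card => d; apply/forallP/familyP => h i; have := h i; rewrite inE.
rewrite card_family foldrE big_map big_enum /=; apply: eq_bigr => i _.
set g := facet_gap r s i; rewrite -sum1_card.
rewrite (eq_bigl (fun x : 'I_q => x < q - g)); last by move=> x /=; rewrite ltn_subRL addnC.
rewrite -(big_ord_widen _ (fun=> 1)) ?leq_subr // sum_nat_const card_ord muln1 //.
Qed.

End SplittingExponents.

Section MaxFreeRank.
Import mpoly.
Context (K : fieldType) (p : nat) (chK : p \in [pchar K]) (n : nat).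
Context (a b : 'I_n -> nat) (a_gt0 : forall i, (0 < a i)%N) (b_gt0 : forall i, (0 < b i)%N).
Context (e : nat).
Local Notation S := {mpoly {mpoly K[n]}[2]}.
Local Notation B := (intersection_algebra K a b).
Local Notation mono := (@uvx_monomial K n).
Context (L : comNzRingType) (chL : p \in [pchar L]) (to_local : {rmorphism B -> L}).
Hypothesis to_local_inj : injective to_local.
Hypothesis to_local_unit : forall s, constant_coeff K a b s != 0 -> exists t, to_local s * t = 1.
Hypothesis local_fraction : forall y, exists f s, constant_coeff K a b s != 0 /\ y * to_local s = to_local f.
Local Notation M := (Frobenius_push chL e).
Local Notation q := (p ^ e)%N.
Local Notation term := (@term K n a b).
Local Notation in_cone := (@in_cone n a b).
Local Notation val_term := (@val_term K n a b).

Lemma gen_exp_gt0 k i : (0 < gen_exp a b k i)%N.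
Proof. by rewrite /gen_exp; case: eqP. Qed.

(** Compare the coefficients at the exponent of h in s h = g f: on the right it
    would be a coefficient of f at h - g, which is outside the cone. *)
Lemma mono_nodiv mh ch mg cg (s f : B) :
  in_cone mh ch -> in_cone mg cg ->
  ((mg <= mh)%MM -> (cg <= ch)%MM -> ~ in_cone (mh - mg) (ch - cg)) ->
  s * term 1 mh ch = term 1 mg cg * f -> constant_coeff K a b s = 0.
Proof.
move=> hC gC nC eqsf.
have : val (term 1 mh ch) * val s = val (term 1 mg cg) * val f.
  rewrite [LHS]mulrC.
  by rewrite -(ia_valM s) eqsf (ia_valM (term 1 mg cg)).
rewrite (val_term _ hC) (val_term _ gC).
move=> /(congr1 (mcoeff mh))/(congr1 (mcoeff ch)).
rewrite !mcoeff_termM !mul1r constant_coeffE.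
have -> : (mh <= mh)%MM && (ch <= ch)%MM by apply/andP; split; exact: lepm_refl.
have -> : (mh - mh = 0)%MM by apply/mnmP => i; rewrite mnmBE mnm0E subnn.
have -> : (ch - ch = 0)%MM by apply/mnmP => i; rewrite mnmBE mnm0E subnn.
move=> ->; case: ifP => // /andP[mm cc].
have /in_intersection fB := valP f.
apply/eqP; apply: contra_notT (nC mm cc) => fn0; exact: fB.
Qed.

Lemma val_expM_term z m c mh ch r : in_cone m c -> in_cone mh ch ->
  val (term 1 mh ch ^+ r * term z m c) = z%:MP *: mono (c + ch *+ r) (m + mh *+ r).
Proof.
move=> mc hC; rewrite ia_valM ia_valX (val_term _ hC) (val_term _ mc).
by rewrite [1%:MP]rmorph1 scale1r monoX -scalerAr -monoD (addmC c) (addmC m).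
Qed.

Lemma term_sum (I : finType) (z : I -> K) m c : in_cone m c ->
  term (\sum_i z i) m c = \sum_i term (z i) m c.
Proof.
move=> mc; apply: val_inj; rewrite (val_term _ mc) raddf_sum scaler_suml.
transitivity (\sum_i val (term (z i) m c)).
  by apply: eq_bigr => i _; rewrite (val_term _ mc).
by rewrite -(raddf_sum (val : {additive B -> S})).
Qed.

Lemma term_expM z w m c r : in_cone m c ->
  term (z ^+ r * w) m c = term z 0%MM 0%MM ^+ r * term w m c.
Proof.
move=> mc; have C0 : in_cone 0%MM 0%MM by move=> k i; rewrite mnm0E.
apply: val_inj; rewrite ia_valM ia_valX (val_term _ mc) (val_term _ mc) (val_term _ C0).
rewrite mpolyCM rmorphXn exprZn /uvx_monomial !mpolyX0 scale1r expr1n.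
by rewrite -scalerAl mul1r [RHS]scalerA.
Qed.

Lemma nonunit_term (res : {rmorphism L -> K})
    (resE : forall f, res (to_local f) = constant_coeff K a b f)
    z m c m' c' mh ch mg cg :
  in_cone m c -> in_cone m' c' -> in_cone mh ch -> in_cone mg cg ->
  (m + mh *+ q = m' + mg *+ q)%MM -> (c + ch *+ q = c' + cg *+ q)%MM ->
  ((mg <= mh)%MM -> (cg <= ch)%MM -> ~ in_cone (mh - mg) (ch - cg)) ->
  forall Phi : {linear M -> L^o}, res (Phi (to_local (term z m c))) = 0.
Proof.
move=> mc mc' hC gC em ec nC Phi.
apply: (Frobenius_nonunit to_local_inj local_fraction resE
  (z' := term z m' c') (h := term 1 mh ch) (g := term 1 mg cg)); last first.
  by move=> f s; apply: mono_nodiv.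
apply: val_inj; transitivity (z%:MP *: mono (c + ch *+ q) (m + mh *+ q)).
  exact: val_expM_term.
by rewrite em ec; apply/esym; exact: val_expM_term.
Qed.

(** The Laurent monomial h / g is one on which the facet form that is >= q takes
    the value -1 and all others are >= 0: it is x^a / (u x^a) for r and
    u x^a / x_j for c_j - r a_j, with v and b in place of u and a for the other
    two kinds of facets. *)
Lemma nonsplitting_term (res : {rmorphism L -> K})
    (resE : forall f, res (to_local f) = constant_coeff K a b f)
    z m c : in_cone m c -> ~ splitting_exponent a b q m c ->
  forall Phi : {linear M -> L^o}, res (Phi (to_local (term z m c))) = 0.
Proof.
move=> mc Nsplits.
have [/existsP[k mk]|/existsPn mq] := boolP [exists k, (q <= m k)%N].
  apply: (@nonunit_term res resE z m c ((m - U_(k) *+ q)%MM) c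
    0%MM ([multinom gen_exp a b k i | i < n])
    (U_(k)%MM) ([multinom gen_exp a b k i | i < n])) => //.
  - by move=> k' i; rewrite mnmBE (leq_trans _ (mc k' i)) // leq_mul2r leq_subr orbT.
  - by move=> k' i; rewrite mnm0E.
  - by move=> k' i; rewrite mnm1E mnmE; case: eqP => [->|] //; rewrite mul1n.
  - apply/mnmP => k'; rewrite !(mnmDE, mulmnE, mnmBE, mnm1E, mnm0E).
    by case: eqP => [<-|_]; lia.
  - by move=> /mnm_lepP/(_ k); rewrite mnm1E mnm0E eqxx.
have [/existsP[k /existsP[j ckj]]|/existsPn cq] :=
    boolP [exists k, exists i, (q + m k * gen_exp a b k i <= c i)%N]; last first.
  case: Nsplits; split=> // [k|k i]; first by rewrite ltnNge.
  by have /existsPn/(_ i) := cq k; rewrite -ltnNge.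
apply: (@nonunit_term res resE z m c ((m + U_(k) *+ q)%MM)
    ((c + [multinom gen_exp a b k i | i < n] *+ q - U_(j) *+ q)%MM)
    (U_(k)%MM) ([multinom gen_exp a b k i | i < n])
    0%MM (U_(j)%MM)) => //.
- move=> k' i; rewrite !(mnmDE, mulmnE, mnmBE, mnm1E, mnmE).
  have := mc k' i; have := gen_exp_gt0 k i.
  case: (eqVneq k k') => [<-|_]; case: (eqVneq j i) => [<-|_]; rewrite ?(mul0n, mul1n, addn0, subn0).
  + move=> _ _; have := ckj; rewrite mulnDl [(gen_exp _ _ _ _ * _)%N]mulnC; lia.
  + by move=> _; rewrite mulnDl [(gen_exp _ _ _ _ * _)%N]mulnC leq_add2r.
  + move=> w0 /leq_trans; apply; rewrite -addnBA ?leq_addr // -{1}[q]mul1n.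
    by rewrite leq_mul2r w0 orbT.
  + by move=> _ /leq_trans; apply; rewrite leq_addr.
- by move=> k' i; rewrite mnm1E mnmE; case: eqP => [->|] //; rewrite mul1n.
- by move=> k' i; rewrite mnm0E.
- by apply/mnmP => i; rewrite !(mnmDE, mulmnE, mnm1E, mnm0E); lia.
- apply/mnmP => i; rewrite !(mnmDE, mulmnE, mnmBE, mnm1E, mnmE).
  by case: eqP => [<-|_]; have := ckj; lia.
- move=> _ _ /(_ k j); rewrite !(mnmBE, mnm1E, mnm0E, mnmE) !eqxx mul1n.
  by have := gen_exp_gt0 k j; lia.
Qed.

Lemma splitting_exponent_eq m c m' c' (m1 : 'X_{1..2}) (c1 : 'X_{1..n}) :
  splitting_exponent a b q m c -> splitting_exponent a b q m' c' ->
  (m' == m + m1 *+ q)%MM && (c' == c + c1 *+ q)%MM =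
  [&& m' == m, c' == c, m1 == 0%MM & c1 == 0%MM].
Proof.
move=> [mc mq cq] [mc' mq' cq'].
apply/andP/and4P => [[/eqP em /eqP ec]|[/eqP-> /eqP-> /eqP-> /eqP->]]; last first.
  by split; apply/eqP/mnmP => i; rewrite !(mnmDE, mulmnE, mnm0E) mul0n addn0.
have m10 : m1 = 0%MM.
  apply/mnmP => k; rewrite mnm0E; have := mq' k; rewrite em mnmDE mulmnE.
  by case: (m1 k) => // r; rewrite mulSn; lia.
have emm : m' = m by rewrite em m10; apply/mnmP => i; rewrite !(mnmDE, mulmnE, mnm0E) mul0n addn0.
have c10 : c1 = 0%MM.
  apply/mnmP => i; rewrite mnm0E; have := cq' ord0 i; have := mc ord0 i.
  rewrite emm ec mnmDE mulmnE; case: (c1 i) => // r; rewrite mulSn; lia.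
split; apply/eqP => //.
by rewrite ec c10; apply/mnmP => i; rewrite !(mnmDE, mulmnE, mnm0E) mul0n addn0.
Qed.

(** The splitting monomials w_t x^c u^r v^s span residually, which bounds the
    rank above; the root maps [extract] are dual to them, which bounds it
    below. *)
Theorem Frobenius_max_free_rank D : is_frobenius_degree K p D ->
  is_max_free_rank M
    (D ^ e * \sum_(r < q) \sum_(s < q) \prod_(i < n) (q - facet_gap a b r s i))%N.
Proof.
move=> /(Frobenius_basis chK e)[T [w [co [cardT coM cow coE]]]].
rewrite -card_splitting_code -cardT.
have q_gt0 : (0 < q)%N by exact: (q_gt0 chK e).
pose G := {g : 'I_q * 'I_q * {ffun 'I_n -> 'I_q} | g \in splitting_code a b}.
have <- : #|{: T * G}| = (#|T| * #|splitting_code (q := q) a b|)%N.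
  by rewrite card_prod card_sig; congr (_ * _)%N; apply: eq_card => g.
pose t_ (j : 'I_#|{: T * G}|) : T := (enum_val j).1.
pose g_ (j : 'I_#|{: T * G}|) := val (enum_val j).2.
pose gen j := term (w (t_ j)) (code_m (g_ j)) (code_c a b (g_ j)).
have splits j : splitting_exponent a b q (code_m (g_ j)) (code_c a b (g_ j)).
  exact: code_splitting (valP (enum_val j).2).
split; last first.
  have [res resE] := residue_map to_local_inj local_fraction.
  move=> c'; apply: (@free_summand_rank_le L M K res _ (fun j => to_local (gen j) : M)).
  apply: (spanned_all to_local_unit local_fraction).
  have sp0 : residually_spanned chL e to_local res gen (to_local 0).
    by apply: spanned0 => Phi; rewrite rmorph0 linear0 rmorph0.
  elim/intersection_ind => [|f g spf spg|z m c mc]; first exact: sp0.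
    by rewrite rmorphD; apply: spannedD.
  have -> : term z m c = \sum_t term (co t z) 0%MM 0%MM ^+ q * term (w t) m c.
    by rewrite {1}(coE z) term_sum //; apply: eq_bigr => t _; rewrite term_expM.
  rewrite rmorph_sum; elim/big_ind: _ => [|x y|t _].
  - by have := sp0; rewrite rmorph0.
  - exact: spannedD.
  rewrite rmorphM rmorphXn; apply: spannedZ.
  case: (pselect (splitting_exponent a b q m c)) => [/splitting_coded[g gG [<- <-]]|Nsplits].
    pose j := enum_rank (t, exist _ g gG : G).
    have -> : term (w t) (code_m g) (code_c a b g) = gen j.
      by rewrite /gen /t_ /g_ /j enum_rankK.
    exact: spanned_gen.
  by apply: spanned0; apply: nonsplitting_term.
have chS : p \in [pchar S].
  exact: (rmorph_pchar (@mpolyC 2 _) (rmorph_pchar (@mpolyC n K) chK)).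
have qD : {morph (fun g : S => g ^+ q) : x y / x + y} := @pchar_expD _ _ chS e.
pose ps j := extract q_gt0 (code_m (g_ j)) (code_c a b (g_ j)) (co (t_ j)).
have psB j (f : B) : ps j (val f) \in intersection_pred a b.
  exact: extract_intersection (splits j) _ _ (valP f).
pose phi j (f : B) : B := IntersectionAlgebra (psB j f).
have phiD j : {morph phi j : x y / x + y}.
  by move=> x y; apply: val_inj; exact: (raddfD (ps j) (val x) (val y)).
have phiM j g f : phi j (g ^+ q * f) = g * phi j f.
  apply: val_inj; transitivity (val g * ps j (val f)); last by rewrite ia_valM.
  rewrite -(extract_semilinear q_gt0 (splits j) (coM _) qD (val g) (valP f)).
  by rewrite -ia_valX -ia_valM.
have [Phi PhiE] := choice (fun j => Frobenius_extension chL to_local_inj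
  to_local_unit local_fraction (phiD j) (phiM j)).
apply: (@dual_system_free_summand L M _ (fun j => to_local (gen j) : M) Phi) => i j.
rewrite PhiE -[RHS](rmorph_nat to_local); congr (to_local _); apply: val_inj.
rewrite rmorph_nat /=; apply/mpolyP => m; apply/mpolyP => c.
rewrite mcoeff_extract (val_term _ _); last by case: (splits j).
rewrite mcoeffZ mcoeffCM mcoeff_mono splitting_exponent_eq //.
have [<-|ij] := eqVneq i j; last first.
  rewrite !mcoeff0; case: and4P => [[/eqP em /eqP ec _ _]|_]; last by rewrite mulr0 raddf0.
  rewrite mulr1 cow; case: eqVneq => // et; case/eqP: ij; apply: enum_val_inj.
  rewrite [LHS]surjective_pairing [RHS]surjective_pairing; congr (_, _) => //.
  by apply/val_inj/esym; exact: code_inj em ec.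
rewrite !eqxx /= mcoeff1; have [m0|_] /= := eqVneq m 0%MM; last first.
  by rewrite mulr0 raddf0 mcoeff0.
by rewrite mcoeff1; case: (c == 0%MM); rewrite ?mulr1 ?mulr0 ?raddf0 // cow eqxx.
Qed.

End MaxFreeRank.

(** * Krull dimension *)

Section PrimeIdeal.
Context (A : comNzRingType) (P : {pred A}) (P_prime : is_prime_ideal P).

Lemma prime0 : 0 \in P. Proof. by case: P_prime => -[]. Qed.

Lemma prime1 : 1 \notin P. Proof. by case: P_prime => -[]. Qed.

Lemma primeMl x y : x \in P -> y * x \in P.
Proof.
by case: P_prime => -[P0 _ PL] _ xP; have := PL y x 0 xP P0; rewrite addr0.
Qed.

Lemma primeB x y : x \in P -> y \in P -> x - y \in P.
Proof.
by case: P_prime => -[_ _ PL] _ xP yP; have := PL (-1) y x yP xP; rewrite mulN1r addrC.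
Qed.

Lemma primeM x y : x * y \in P -> x \notin P -> y \in P.
Proof. by case: P_prime => _ PM /PM/orP[->|]. Qed.

Lemma primeX x r : x \notin P -> x ^+ r \notin P.
Proof.
move=> xP; elim: r => [|r IH]; first by rewrite expr0 prime1.
by rewrite exprS; apply: contra IH => h; exact: primeM h xP.
Qed.

End PrimeIdeal.

Lemma kernel_prime (A : comNzRingType) (D : idomainType)
    (h : {rmorphism A -> D}) : is_prime_ideal (fun f => h f == 0).
Proof.
split; first split.
- by apply/eqP; exact: rmorph0.
- by apply/negP => /eqP/eqP; rewrite rmorph1 oner_eq0.
- by move=> f u v /eqP u0 /eqP v0; apply/eqP; rewrite rmorphD rmorphM u0 v0 mulr0 addr0.
by move=> f g /eqP/eqP; rewrite rmorphM mulf_eq0.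
Qed.

Section ExponentBox.
Context (N : nat).

Fixpoint exponent_lists (m : nat) : seq (seq nat) :=
  if m is m'.+1 then [seq j :: al | j <- iota 0 N, al <- exponent_lists m'] else [:: [::]].

Lemma size_exponent_lists m : size (exponent_lists m) = (N ^ m)%N.
Proof. by elim: m => //= m IH; rewrite size_allpairs IH size_iota expnS. Qed.

Lemma uniq_exponent_lists m : uniq (exponent_lists m).
Proof.
elim: m => //= m IH; apply: allpairs_uniq => //; first exact: iota_uniq.
by move=> [j al] [j' al'] _ _ [-> ->].
Qed.

Fixpoint list_power (A : comNzRingType) (x : nat -> A) (al : seq nat) : A :=
  if al is j :: al' then x 0%N ^+ j * list_power (x \o succn) al' else 1.

(** Collect the relation by powers of x_0 and divide by the lowest one, which is
    possible modulo P_0.  The lowest coefficient, a polynomial in the other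
    x_i, then lies in P_0 + (x_0), hence in P_1, and induction on the length of
    the chain applies. *)
Lemma chain_independent (A : comNzRingType) (K : fieldType) (emb : K -> A) :
  emb 0 = 0 -> (forall z, z != 0 -> exists u, u * emb z = 1) ->
  forall m (P : nat -> {pred A}) (x : nat -> A) (l : seq nat -> K),
  (forall i, (i <= m)%N -> is_prime_ideal (P i)) ->
  (forall i, (i < m)%N -> {subset P i <= P i.+1}) ->
  (forall i, (i < m)%N -> x i \in P i.+1 /\ x i \notin P i) ->
  \sum_(al <- exponent_lists m) emb (l al) * list_power x al \in P 0%N ->
  {in exponent_lists m, forall al, l al = 0}.
Proof.
move=> emb0 embU; elim=> [|m IH] P x l prP subP xP.
  rewrite big_seq1 /= mulr1 => h al; rewrite inE => /eqP->.
  apply/eqP; apply: contraTT h => /embU[u u1].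
  apply: contra (prime1 (prP 0%N isT)) => h; rewrite -u1.
  exact: (primeMl (prP _ _)).
rewrite /= big_allpairs_dep /= => hsum.
pose T j := \sum_(al <- exponent_lists m) emb (l (j :: al)) * list_power (x \o succn) al.
have {}hsum : \sum_(0 <= j < N) x 0%N ^+ j * T j \in P 0%N.
  move: hsum; rewrite /index_iota subn0 (eq_bigr (fun j => x 0%N ^+ j * T j)) // => j _.
  by rewrite mulr_sumr; apply: eq_bigr => al _ /=; rewrite mulrCA.
have [x1 x0] := xP 0%N isT.
suff l0 j : (j < N)%N -> {in exponent_lists m, forall al, l (j :: al) = 0}.
  move=> _ /allpairsP[[j al] [/= jN alm ->]]; apply: l0 => //.
  by move: jN; rewrite mem_iota.
elim/ltn_ind: j => j IHj jN.
apply: (IH (P \o succn) (x \o succn) (fun al => l (j :: al))) => [i im|i im|i im|].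
- exact: prP.
- exact: subP.
- exact: xP.
rewrite -/(T j) /=.
have Tlt i : (i < j)%N -> T i = 0.
  move=> ij; rewrite /T big_seq big1 // => al alm.
  by rewrite (IHj i ij (ltn_trans ij jN) al alm) emb0 mul0r.
pose U := \sum_(j.+1 <= i < N) x 0%N ^+ (i - j.+1) * T i.
have sumE : \sum_(0 <= i < N) x 0%N ^+ i * T i = x 0%N ^+ j * (T j + x 0%N * U).
  rewrite (big_cat_nat _ (n := j)) ?(ltnW jN) //=.
  rewrite big_nat big1 ?add0r => [|i /andP[_ ij]]; last by rewrite Tlt ?mulr0.
  rewrite big_ltn // mulrDr /U !mulr_sumr; congr (_ + _).
  rewrite big_nat [RHS]big_nat; apply: eq_bigr => i /andP[ji _].
  by rewrite !mulrA -exprSr -exprD subnKC.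
move: hsum; rewrite sumE.
move=> /(primeM (prP 0%N isT))/(_ (primeX (prP 0%N isT) j x0)) h.
rewrite -[T j](addrK (x 0%N * U)); apply: (primeB (prP 1%N _)) => //.
  exact: subP.
by rewrite mulrC; apply: (primeMl (prP 1%N _)).
Qed.

End ExponentBox.

Lemma linear_dependence (K : fieldType) (J C : finType) (f : J -> C -> K) :
  (#|C| < #|J|)%N ->
  exists2 l : J -> K, (exists j, l j != 0) & forall c, \sum_j l j * f j c = 0.
Proof.
move=> CJ; pose M : 'M[K]_(#|J|, #|C|) := \matrix_(i, k) f (enum_val i) (enum_val k).
have ker0 : kermx M != 0.
  rewrite -mxrank_eq0 mxrank_ker subn_eq0 -ltnNge.
  by apply: leq_ltn_trans CJ; exact: rank_leq_col.
have /rowV0Pn[v vM v0] := ker0.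
exists (fun j => v 0 (enum_rank j)).
  have /rV0Pn[i vi] := v0; exists (enum_val i); by rewrite enum_valK.
move=> c; have /sub_kermxP/rowP/(_ (enum_rank c)) := vM.
rewrite !mxE => sum0; rewrite -[RHS]sum0.
rewrite [RHS](reindex enum_rank) /=; last exact: onW_bij (@enum_rank_bij J).
by apply: eq_bigr => j _; rewrite mxE !enum_rankK.
Qed.

Section KrullDimension.
Import mpoly.
Context (K : fieldType) (n : nat) (a b : 'I_n -> nat).
Local Notation S := {mpoly {mpoly K[n]}[2]}.
Local Notation B := (intersection_algebra K a b).
Local Notation mono := (@uvx_monomial K n).

Definition bounded (C : nat) (f : S) : Prop :=
  forall m c, f@_m@_c != 0 -> (forall k, (m k <= C)%N) /\ (forall i, (c i <= C)%N).

Lemma bounded_exists f : exists C, bounded C f.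
Proof.
exists (maxn (msize f) (\sum_(m <- msupp f) msize f@_m)) => m c fmc.
have cm : c \in msupp f@_m by rewrite mcoeff_msupp.
have mf : m \in msupp f.
  by rewrite mcoeff_msupp; apply: contraNneq fmc => ->; rewrite mcoeff0.
have mi d (v : 'X_{1..d}) i : (v i <= mdeg v)%N by rewrite mdegE (bigD1 i) //= leq_addr.
split=> [k|i]; rewrite leq_max.
  by rewrite (leq_trans (mi _ m k)) // ltnW // msize_mdeg_lt.
apply/orP; right; apply: (leq_trans (mi _ c i)).
apply: (leq_trans (ltnW (msize_mdeg_lt cm))).
by rewrite (big_rem m) //= leq_addr.
Qed.

Lemma boundedW C C' f : (C <= C')%N -> bounded C f -> bounded C' f.
Proof.
by move=> CC h m c /h[h1 h2]; split=> i; rewrite (leq_trans _ CC).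
Qed.

Lemma bounded1 : bounded 0 1.
Proof.
move=> m c; rewrite mcoeff1; have [->|_] := eqVneq m 0%MM; last first.
  by rewrite mcoeff0 eqxx.
rewrite mcoeff1; have [->|_] := eqVneq c 0%MM; last by rewrite eqxx.
by move=> _; split=> i; rewrite mnm0E.
Qed.

Lemma sum_neq0 (A : nmodType) (I : finType) (Q : pred I) (F : I -> A) :
  \sum_(i | Q i) F i != 0 -> exists2 i, Q i & F i != 0.
Proof.
move=> h; have [/existsP[i /andP[Qi Fi]]|/existsPn h'] := boolP [exists i, Q i && (F i != 0)].
  by exists i.
case/eqP: h; apply: big1 => i Qi; have := h' i; by rewrite Qi negbK => /eqP.
Qed.

Lemma boundedM C C' f g : bounded C f -> bounded C' g -> bounded (C + C') (f * g).
Proof.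
move=> fC gC m c; rewrite mcoeffM raddf_sum => /sum_neq0[d /eqP md /=].
rewrite mcoeffM => /sum_neq0[d' /eqP cd /=].
rewrite mulf_eq0 negb_or => /andP[/fC[f1 f2] /gC[g1 g2]].
by split=> i; [rewrite md | rewrite cd]; rewrite mnmDE leq_add.
Qed.

Lemma boundedX C f r : bounded C f -> bounded (C * r) (f ^+ r).
Proof.
move=> fC; elim: r => [|r IH]; first by rewrite expr0 muln0; exact: bounded1.
by rewrite exprS mulnS; apply: boundedM.
Qed.

Lemma bounded_list_power C N m (x : nat -> S) al :
  (forall i, (i < m)%N -> bounded C (x i)) -> al \in exponent_lists N m ->
  bounded (C * N * m) (list_power x al).
Proof.
elim: m x al => [|m IH] x al xC /=.
  by rewrite inE => /eqP-> /=; rewrite muln0; exact: bounded1.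
case/allpairsP => -[j be] /= [jN bem ->] /=.
rewrite mulnS; apply: boundedM.
  apply: (@boundedW (C * j)); last by apply: boundedX; exact: xC.
  by move: jN; rewrite mem_iota => /andP[_ /ltnW jN]; rewrite leq_mul2l jN orbT.
by apply: IH bem => i im; apply: xC.
Qed.

(** There are N^(n+3) monomials in the x_i with exponents < N, and their supports
    lie in a box with at most (const * N)^(n+2) points, so for N large they are
    linearly dependent. *)
Lemma algebraic_dependence (x : nat -> S) :
  exists (N : nat) (l : seq nat -> K),
    (exists2 al, al \in exponent_lists N n.+3 & l al != 0) /\
    \sum_(al <- exponent_lists N n.+3) (l al)%:MP%:MP * list_power x al = 0.
Proof.
have /choice[C0 C0P] := fun i => bounded_exists (x i).
pose C := \sum_(i < n.+3) C0 i.
have xC i : (i < n.+3)%N -> bounded C (x i).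
  move=> im; apply: boundedW (C0P i).
  by rewrite /C (bigD1 (Ordinal im)) //= leq_addr.
(* E <= (C (n + 3) + 1) N, and N exceeds the (n + 2)-nd power of the constant. *)
pose N := ((C * n.+3).+1 ^ n.+2).+1; pose E := (C * N * n.+3).+1.
have EN : (E ^ n.+2 < N ^ n.+3)%N.
  apply: (@leq_ltn_trans (((C * n.+3).+1 * N) ^ n.+2)).
    by rewrite leq_exp2r // /E; nia.
  by rewrite expnMn expnS ltn_mul2r expn_gt0 /= ltnSn.
pose J := 'I_(size (exponent_lists N n.+3)).
pose CC : finType := ({ffun 'I_2 -> 'I_E} * {ffun 'I_n -> 'I_E})%type.
pose exm (d : CC) : 'X_{1..2} := [multinom d.1 k : nat | k < 2].
pose exc (d : CC) : 'X_{1..n} := [multinom d.2 i : nat | i < n].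
pose y (j : J) : S := list_power x (nth [::] (exponent_lists N n.+3) j).
have [|l [j0 lj0] lE] := @linear_dependence K J CC (fun j d => (y j)@_(exm d)@_(exc d)).
  by rewrite card_ord size_exponent_lists card_prod !card_ffun !card_ord -expnD.
pose la al := if insub (index al (exponent_lists N n.+3)) is Some j then l j else 0.
have laE (j : J) : la (nth [::] (exponent_lists N n.+3) j) = l j.
  by rewrite /la index_uniq ?uniq_exponent_lists // valK.
exists N, la; split.
  by exists (nth [::] (exponent_lists N n.+3) j0); [rewrite mem_nth | rewrite laE].
rewrite (big_nth [::]) big_mkord; apply/mpolyP => m; apply/mpolyP => c.
rewrite !mcoeff0 !raddf_sum /=.
have yE (j : J) : bounded (C * N * n.+3) (y j).
  by apply: bounded_list_power xC _; rewrite mem_nth.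
have [/andP[/forallP mE /forallP cE]|out] :=
    boolP ([forall k, m k < E] && [forall i, c i < E])%N.
  pose d : CC := ([ffun k => Ordinal (mE k)], [ffun i => Ordinal (cE i)]).
  have em : exm d = m by apply/mnmP => i; rewrite mnmE ffunE.
  have ec : exc d = c by apply/mnmP => i; rewrite mnmE ffunE.
  rewrite -[RHS](lE d) em ec.
  by apply: eq_bigr => j _; rewrite !mcoeffCM laE.
apply: big1 => j _; rewrite !mcoeffCM.
have [->|/yE[h1 h2]] := eqVneq (y j)@_m@_c 0; first by rewrite mulr0.
case/negP: out; apply/andP; split; apply/forallP => i; rewrite ltnS; [exact: h1|exact: h2].
Qed.

Lemma ia_valD (f g : B) : val (f + g) = val f + val g :> S.
Proof. exact: (rmorphD (val : {rmorphism B -> S})). Qed.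

Lemma val_list_power (x : nat -> B) al :
  val (list_power x al) = list_power (fun i => val (x i)) al :> S.
Proof.
elim: al x => [|j al IH] x; first exact: (rmorph1 (val : {rmorphism B -> S})).
transitivity (val (x 0%N ^+ j * list_power (x \o succn) al)); first by [].
by rewrite ia_valM ia_valX IH.
Qed.

Lemma krull_dim_le d (P : nat -> {pred B}) : prime_chain d P -> (d <= n.+2)%N.
Proof.
move=> [prP chP]; rewrite leqNgt; apply/negP => dn.
have ex i : exists x : B, (i < d)%N -> x \in P i.+1 /\ x \notin P i.
  have [id|di] := ltnP i d; last by exists 0.
  by have [_ [x x1 x0]] := chP i id; exists x.
have [x xP] := choice ex.
have C0 : in_cone a b 0%MM 0%MM by move=> k i; rewrite mnm0E.
pose cst (z : K) : B := term a b z 0%MM 0%MM.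
have val_cst z : val (cst z) = z%:MP%:MP :> S.
  by rewrite (val_term _ C0) /uvx_monomial !mpolyX0 scale1r -mul_mpolyC mulr1.
have cst0 : cst 0 = 0 by apply: val_inj; rewrite val_cst !rmorph0.
have cstU z : z != 0 -> exists u, u * cst z = 1.
  move=> z0; exists (cst z^-1); apply: val_inj; rewrite ia_valM !val_cst -!rmorphM.
  by rewrite mulVf // !rmorph1.
have [N [l [[al alm lal] lE]]] := algebraic_dependence (fun i => val (x i)).
case/eqP: lal.
apply: (chain_independent cst0 cstU (P := P) (x := x) (l := l) _ _ _ _ alm) => [i im|i im|i im|].
- by apply: prP; apply: leq_trans dn.
- by have [] := chP i (leq_trans im dn).
- exact: xP (leq_trans im dn).
suff -> : \sum_(al <- exponent_lists N n.+3) cst (l al) * list_power x al = 0.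
  exact: prime0 (prP _ _).
apply: val_inj; rewrite [LHS](raddf_sum (val : {additive B -> S})) -[RHS]lE.
apply: eq_bigr => be _; transitivity (val (cst (l be) * list_power x be)); first by [].
rewrite ia_valM val_cst; congr (_ * _).
exact: val_list_power.
Qed.

Section Killing.

Definition kill_power d (A : comNzRingType) (k i : 'I_d) : {mpoly A[d]} :=
  if i == k then 0 else 'X_i.

Lemma mmap1_kill d (A : comNzRingType) (k : 'I_d) (m : 'X_{1..d}) :
  mmap1 (kill_power A k) m = if m k == 0%N then 'X_[m] else 0.
Proof.
rewrite /mmap1 (bigD1 k) //= /kill_power eqxx expr0n; case: eqP => mk.
  rewrite mpolyXE_id [RHS](bigD1 k) //= mk expr0 !mul1r.
  by apply: eq_bigr => i /negPf->.
by rewrite mul0r.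
Qed.

Definition kill_uv (k : 'I_2) : {rmorphism S -> S} :=
  mmap (@mpolyC 2 {mpoly K[n]}) (kill_power {mpoly K[n]} k).

Definition kill_x (j : 'I_n) : {rmorphism S -> S} :=
  map_mpoly (mmap (@mpolyC n K) (kill_power K j)).

(** The variables are ordered u, v, x_1, ..., x_n; this is the order in which the
    chain of primes sets them to zero. *)
Definition kill (i : nat) : {rmorphism S -> S} :=
  match i with
  | 0 => kill_uv ord0
  | 1 => kill_uv ord_max
  | i'.+2 => if insub i' is Some j then kill_x j else idfun
  end.

Definition coordinate (i : nat) (m : 'X_{1..2}) (c : 'X_{1..n}) : nat :=
  match i with
  | 0 => m ord0
  | 1 => m ord_max
  | i'.+2 => if insub i' is Some j then c j else 0%N
  end.

Lemma kill_mono i m c :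
  kill i (mono c m) = if coordinate i m c == 0%N then mono c m else 0.
Proof.
have uv k : kill_uv k (mono c m) = if m k == 0%N then mono c m else 0.
  rewrite /kill_uv /= /uvx_monomial mmapZ mmapX mmap1_kill.
  by case: ifP => _; rewrite ?mulr0 // mul_mpolyC.
case: i => [|[|i]] /=; [exact: uv|exact: uv|].
case: insubP => [j _ _|_] //=.
rewrite /kill_x /= /uvx_monomial map_mpolyZ map_mpolyX /= mmapX mmap1_kill.
by case: ifP => _ //; rewrite scale0r.
Qed.

Fixpoint kill_below (i : nat) : {rmorphism S -> S} :=
  if i is i'.+1 then kill i' \o kill_below i' else idfun.

Lemma kill_below_mono i m c : (forall j, (j < i)%N -> coordinate j m c = 0%N) ->
  kill_below i (mono c m) = mono c m.
Proof.
elim: i => [|i IH] h //=; rewrite IH => [|j ji]; last by apply: h; exact: ltnW.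
by rewrite kill_mono h.
Qed.

Lemma mono_neq0 m c : mono c m != 0.
Proof.
apply/eqP => /(congr1 (mcoeff m))/(congr1 (mcoeff c)).
by rewrite mcoeff_mono !eqxx !mcoeff0 => /eqP; rewrite oner_eq0.
Qed.

Definition kill_ideal (i : nat) : {pred B} := fun f => kill_below i (val f) == 0.

Lemma kill_ideal_prime i : is_prime_ideal (kill_ideal i).
Proof.
pose h : {rmorphism B -> S} := kill_below i \o val.
exact: (@kernel_prime B S h).
Qed.

(** The steps are strict because of the monomials u x^a, v x^b and x_j. *)
Lemma prime_chain_exists : prime_chain n.+2 kill_ideal.
Proof.
split=> [i _|i ilt]; first exact: kill_ideal_prime.
split=> [f|]; first by move=> /eqP f0; apply/eqP; rewrite /= f0 rmorph0.
have [m [c [mc below at_i]]] : exists m c, [/\ in_cone a b m c,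
    forall j, (j < i)%N -> coordinate j m c = 0%N & coordinate i m c != 0%N].
  case: i ilt => [|[|i]] ilt.
  - exists U_(ord0)%MM, [multinom a i | i < n]; split=> // [k i|].
      rewrite mnm1E mnmE /gen_exp; case: (ord2P k) => -> //=.
      by rewrite mul1n.
    by rewrite /= mnm1E.
  - exists U_(ord_max)%MM, [multinom b i | i < n]; split=> // [k i|[]//|].
    + rewrite mnm1E mnmE /gen_exp; case: (ord2P k) => -> //=.
      by rewrite mul1n.
    + by rewrite /= mnm1E.
    + by rewrite /= mnm1E.
  - have iln : (i < n)%N by [].
    exists 0%MM, U_(Ordinal iln)%MM; split=> [k j|[|[|j]] ji|] /=; rewrite ?mnm0E //.
      case: insubP => // j' _ j'j; rewrite mnm1E -val_eqE /= j'j.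
      by case: eqP ji => // ->; rewrite ltnn.
    by rewrite insubT mnm1E -val_eqE /= eqxx.
have tE : val (term a b 1 m c) = mono c m by rewrite (val_term _ mc) rmorph1 scale1r.
exists (term a b 1 m c).
  by apply/eqP; rewrite tE /= kill_below_mono // kill_mono (negPf at_i).
by apply/negP => /eqP; rewrite tE kill_below_mono // => m0; case/eqP: (mono_neq0 m c).
Qed.

End Killing.

Theorem krull_dim_intersection : is_krull_dim B n.+2.
Proof.
split; first by exists kill_ideal; exact: prime_chain_exists.
exact: krull_dim_le.
Qed.

End KrullDimension.

(** * Elementary symmetric polynomials *)

Section MesymEval.
Import mpoly.

Lemma mesym_meval (A : comNzRingType) n (v : 'I_n -> A) i :
  (mesym n A i).@[v] = \sum_(h : {set 'I_n} | #|h| == i) \prod_(j in h) v j.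
Proof.
rewrite /mesym raddf_sum; apply: eq_bigr => h _.
transitivity (\prod_(j in h) meval v 'X_j).
  exact: (big_morph (meval v) (mevalM v) (meval1 v)).
by apply: eq_bigr => j _; rewrite mevalXU.
Qed.

End MesymEval.


From mathcomp Require Import all_reals all_analysis.
Import numFieldNormedType.Exports.
Local Open Scope classical_set_scope.
Local Open Scope ring_scope.

(** * Taylor bounds and Riemann sums *)

Section TaylorBound.
Context (R : realFieldType).
Implicit Types (F f : R -> R) (x y : R).

(** A quantitative form of F' = f with f Lipschitz.  Asking it for x and y in
    both orders makes it survive gluing along a point, where two-sided
    derivatives would need separate care. *)
Definition taylor1_bound (I : R -> Prop) F f (L : R) : Prop :=
  0 <= L /\ forall x y, I x -> I y ->
    `|F y - F x - (y - x) * f x| <= L * (y - x) ^+ 2.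

(** Add the bounds for (x, y) and (y, x): the values of F cancel. *)
Lemma taylor1_lipschitz I F f L : taylor1_bound I F f L ->
  forall x y, I x -> I y -> `|f y - f x| <= 2 * L * `|y - x|.
Proof.
move=> [L0 h] x y Ix Iy; have [->|xy] := eqVneq x y.
  by rewrite !subrr normr0 mulr0.
have d0 : 0 < `|y - x| by rewrite normr_gt0 subr_eq0 eq_sym.
rewrite -(ler_pM2l d0) -normrM.
have -> : (y - x) * (f y - f x) = (F y - F x - (y - x) * f x)
    + (F x - F y - (x - y) * f y) by ring.
rewrite (le_trans (ler_normD _ _)) // (le_trans (lerD (h x y Ix Iy) (h y x Iy Ix))) //.
have -> : (x - y) ^+ 2 = (y - x) ^+ 2 by ring.
rewrite -(real_normK (num_real (y - x))); set d := `|y - x|.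
by lra.
Qed.

(** Split the error term at v; the cross term (y - v) (f v - f x) is controlled by
    the Lipschitz bound for f. *)
Lemma taylor1_glue (I J : R -> Prop) v F f L L' :
  (forall x, I x -> x <= v) -> (forall x, J x -> v <= x) -> I v -> J v ->
  taylor1_bound I F f L -> taylor1_bound J F f L' ->
  taylor1_bound (fun x => I x \/ J x) F f (2 * (L + L')).
Proof.
move=> Iv Jv vI vJ hI hJ; have lI := taylor1_lipschitz hI; have lJ := taylor1_lipschitz hJ.
case: hI hJ => [L0 hI] [L'0 hJ]; split; first by rewrite mulr_ge0 ?addr_ge0.
have step x y : `|F y - F v - (y - v) * f v| + `|F v - F x - (v - x) * f x|
      + `|y - v| * `|f v - f x| >= `|F y - F x - (y - x) * f x|.
  rewrite -normrM; set A := F y - F v - _; set B := F v - F x - _.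
  have -> : F y - F x - (y - x) * f x = A + B + (y - v) * (f v - f x) by rewrite /A /B; ring.
  by rewrite (le_trans (ler_normD _ _)) // lerD2r ler_normD.
have sq (M M' x y : R) : 0 <= M -> 0 <= M' -> 0 <= (y - v) * (v - x) ->
    M * (y - v) ^+ 2 + M' * (v - x) ^+ 2 + `|y - v| * (2 * M' * `|v - x|)
      <= 2 * (M + M') * (y - x) ^+ 2.
  move=> M0 M'0 s0; rewrite [`|y - v| * _]mulrCA -normrM (ger0_norm s0).
  have -> : (y - x) ^+ 2 = (y - v) ^+ 2 + (v - x) ^+ 2 + 2 * ((y - v) * (v - x)) by ring.
  have s1 := sqr_ge0 (y - v); have s2 := sqr_ge0 (v - x).
  move: ((y - v) ^+ 2) ((v - x) ^+ 2) ((y - v) * (v - x)) s0 s1 s2 => s t u u0 s0 t0.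
  by nra.
move=> x y [Ix|Jx] [Iy|Jy].
- rewrite (le_trans (hI _ _ Ix Iy)) // ler_wpM2r ?sqr_ge0 //; lra.
- apply: le_trans (step x y) _.
  apply: (@le_trans _ _ (L' * (y - v) ^+ 2 + L * (v - x) ^+ 2
      + `|y - v| * (2 * L * `|v - x|))).
    by apply: lerD; [apply: lerD; [exact: hJ|exact: hI]|rewrite ler_wpM2l // lI].
  rewrite [L + L']addrC; apply: sq => //.
  by rewrite mulr_ge0 // subr_ge0; [exact: Jv|exact: Iv].
- apply: le_trans (step x y) _.
  apply: (@le_trans _ _ (L * (y - v) ^+ 2 + L' * (v - x) ^+ 2
      + `|y - v| * (2 * L' * `|v - x|))).
    by apply: lerD; [apply: lerD; [exact: hI|exact: hJ]|rewrite ler_wpM2l // lJ].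
  by apply: sq => //; rewrite mulr_le0 // subr_le0; [exact: Iv|exact: Jv].
- rewrite (le_trans (hJ _ _ Jx Jy)) // ler_wpM2r ?sqr_ge0 //; lra.
Qed.

Lemma taylor1_sub (I J : R -> Prop) F f L : (forall x, I x -> J x) ->
  taylor1_bound J F f L -> taylor1_bound I F f L.
Proof. by move=> IJ [L0 h]; split=> // x y /IJ Jx /IJ Jy; exact: h. Qed.

Lemma taylor1_ext (I : R -> Prop) F F' f f' L :
  (forall x, I x -> F' x = F x) -> (forall x, I x -> f' x = f x) ->
  taylor1_bound I F f L -> taylor1_bound I F' f' L.
Proof.
by move=> eF ef [L0 h]; split=> // x y Ix Iy; rewrite !eF // ef // h.
Qed.

Lemma taylor1_affine (I : R -> Prop) c d : taylor1_bound I (fun x => c + d * x) (fun=> d) 0.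
Proof.
split=> // x y _ _; rewrite mul0r.
have -> : c + d * y - (c + d * x) - (y - x) * d = 0 by ring.
by rewrite normr0.
Qed.

(** The sign s is 1 for an even and -1 for an odd extension of F. *)
Lemma taylor1_reflect (I : R -> Prop) F f s L : `|s| = 1 ->
  taylor1_bound I F f L ->
  taylor1_bound (fun x => I (- x)) (fun x => s * F (- x)) (fun x => - s * f (- x)) L.
Proof.
move=> s1 [L0 h]; split=> // x y Ix Iy.
have -> : s * F (- y) - s * F (- x) - (y - x) * (- s * f (- x)) =
  s * (F (- y) - F (- x) - (- y - - x) * f (- x)) by ring.
have -> : (y - x) ^+ 2 = (- y - - x) ^+ 2 by ring.
by rewrite normrM s1 mul1r h.
Qed.

(** By induction: the error term of p X + c is x times that of p plus
    (y - x) (p(y) - p(x)). *)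
Lemma taylor1_poly (p : {poly R}) (M : R) : 0 <= M ->
  exists L, taylor1_bound (fun x => `|x| <= M) (horner p) (horner p^`()) L.
Proof.
move=> M0; elim/poly_ind: p => [|p c [L tL]].
  exists 0; split=> // x y _ _; rewrite deriv0 !horner0 mulr0 !subrr normr0.
  by rewrite mul0r.
have lip := taylor1_lipschitz tL; case: tL => L0 h.
pose N := `|p^`().[0]| + 2 * L * M.
have N0 : 0 <= N by rewrite addr_ge0 // !mulr_ge0.
have dN x : `|x| <= M -> `|p^`().[x]| <= N.
  move=> xM; have := lip 0 x; rewrite normr0 subr0 => /(_ M0 xM) h1.
  rewrite -[p^`().[x]](subrK p^`().[0]) addrC (le_trans (ler_normD _ _)) // lerD2l.
  by rewrite (le_trans h1) // ler_wpM2l // mulr_ge0.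
have pl x y : `|x| <= M -> `|y| <= M -> `|p.[y] - p.[x]| <= (2 * L * M + N) * `|y - x|.
  move=> xM yM; rewrite -[p.[y] - p.[x]](subrK ((y - x) * p^`().[x])).
  apply: le_trans (ler_normD _ _) _; rewrite [leRHS]mulrDl; apply: lerD.
    rewrite (le_trans (h _ _ xM yM)) // -(real_normK (num_real (y - x))) expr2 mulrA.
    rewrite ler_wpM2r // [2 * L]mulrC -mulrA ler_wpM2l //.
    by rewrite (le_trans (ler_normB _ _)) //; lra.
  by rewrite normrM mulrC ler_wpM2r // dN.
exists (M * L + (2 * L * M + N)); split; first by rewrite !addr_ge0 // !mulr_ge0.
move=> x y xM yM; rewrite derivD derivM derivX derivC mulr1 addr0 !(hornerD, hornerM, hornerX, hornerC).
have -> : p.[y] * y + c - (p.[x] * x + c) - (y - x) * (p^`().[x] * x + p.[x]) =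
  x * (p.[y] - p.[x] - (y - x) * p^`().[x]) + (y - x) * (p.[y] - p.[x]) by ring.
apply: le_trans (ler_normD _ _) _; rewrite !normrM (mulrDl (M * L)); apply: lerD.
  by rewrite -mulrA ler_pM // h.
rewrite -(real_normK (num_real (y - x))) expr2 mulrCA ler_wpM2l //.
exact: pl.
Qed.

Lemma taylor1_riemann F f L : taylor1_bound (fun=> True) F f L ->
  forall (q : nat) x h, (0 < q)%N ->
  `|F (x + h) - F x - h * (q%:R^-1 * \sum_(r < q) f (x + h * (r%:R / q%:R)))|
    <= L * h ^+ 2 / q%:R.
Proof.
move=> [L0 tL] q x h q0; have qn0 : q%:R != 0 :> R by rewrite pnatr_eq0 -lt0n.
pose z (r : nat) := x + h * (r%:R / q%:R).
have -> : F (x + h) - F x = \sum_(r < q) (F (z r.+1) - F (z r)).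
  rewrite -(big_mkord xpredT (fun r => F (z r.+1) - F (z r))) telescope_sumr // /z.
  by rewrite divff // mulr1 mul0r mulr0 addr0.
have dz (r : nat) : z r.+1 - z r = h / q%:R by rewrite /z -natr1; field.
rewrite mulrA mulr_sumr -sumrB (le_trans (ler_norm_sum _ _ _)) //.
rewrite (_ : L * h ^+ 2 / q%:R = \sum_(r < q) L * (h / q%:R) ^+ 2); last first.
  by rewrite sumr_const card_ord -[RHS]mulr_natr; field.
by apply: ler_sum => r _; rewrite -(dz r); exact: tL.
Qed.

End TaylorBound.

(** * The band around the diagonal *)

Section Band.
Context (R : realFieldType) (P0 P1 P2 : {poly R}) (c : R).
Hypothesis (c_ge0 : 0 <= c) (P1' : P1^`() = P0) (P2' : P2^`() = P1).
Hypothesis (P0c : P0.[c] = 0) (P10 : P1.[0] = 0).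

(** With P0 = \prod_i (1 - b_i X) and c = 1 / b_1, [band0] is
    \prod_i max(0, 1 - b_i |x|); [band1] and [band2] are its odd first and even
    second antiderivatives, and [half1], [half2] their restrictions to x >= 0. *)
Definition band0 (x : R) : R := P0.[Num.min `|x| c].
Definition half1 (x : R) : R := P1.[Num.min x c].
Definition band1 (x : R) : R := if 0 <= x then half1 x else - half1 (- x).
Definition half2 (x : R) : R := P2.[Num.min x c] + P1.[c] * (x - Num.min x c).
Definition band2 (x : R) : R := half2 `|x|.

Lemma taylor1_half1 :
  exists L, taylor1_bound (fun x => 0 <= x) half1 (fun x => P0.[Num.min x c]) L.
Proof.
have [L tL] := taylor1_poly P1 c_ge0; exists (2 * (L + 0)).
apply: (@taylor1_sub _ _ (fun x => (0 <= x /\ x <= c) \/ c <= x)) => [x x0|].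
  by case: (leP x c) => [xc|/ltW cx]; [left|right].
apply: (@taylor1_glue _ _ _ c) => //; first by move=> x [].
  apply: taylor1_ext (taylor1_sub _ tL) => x [x0 xc]; rewrite /half1 ?min_l ?P1' //.
  by rewrite ger0_norm.
apply: taylor1_ext (taylor1_affine _ P1.[c] 0) => x cx; rewrite /half1 min_r //.
by rewrite mul0r addr0.
Qed.

Lemma taylor1_half2 : exists L, taylor1_bound (fun x => 0 <= x) half2 half1 L.
Proof.
have [L tL] := taylor1_poly P2 c_ge0; exists (2 * (L + 0)).
apply: (@taylor1_sub _ _ (fun x => (0 <= x /\ x <= c) \/ c <= x)) => [x x0|].
  by case: (leP x c) => [xc|/ltW cx]; [left|right].
apply: (@taylor1_glue _ _ _ c) => //; first by move=> x [].
  apply: taylor1_ext (taylor1_sub _ tL) => x [x0 xc]; rewrite /half1 /half2 ?min_l ?P2' //.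
    by rewrite subrr mulr0 addr0.
  by rewrite ger0_norm.
apply: taylor1_ext (taylor1_affine _ (P2.[c] - P1.[c] * c) P1.[c]) => x cx;
  rewrite /half1 /half2 min_r //; ring.
Qed.

Lemma half1_0 : half1 0 = 0. Proof. by rewrite /half1 min_l. Qed.

Lemma taylor1_band1 : exists L, taylor1_bound (fun=> True) band1 band0 L.
Proof.
have [L tL] := taylor1_half1; exists (2 * (L + L)).
apply: (@taylor1_sub _ _ (fun x => 0 <= - x \/ 0 <= x)) => [x _|].
  by rewrite oppr_ge0; case: (leP x 0) => [|/ltW]; [left|right].
apply: (@taylor1_glue _ _ _ 0) => //; rewrite ?oppr0 //.
- by move=> x; rewrite oppr_ge0.
- have N1 : `|-1| = 1 :> R by rewrite normrN1.
  apply: taylor1_ext (taylor1_reflect N1 tL) => x; rewrite oppr_ge0 => x0.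
    rewrite /band1 mulN1r; case: ifP => // x0'.
    have -> : x = 0 by apply/eqP; rewrite eq_le x0 x0'.
    by rewrite oppr0 half1_0 oppr0.
  by rewrite /band0 ler0_norm // opprK mul1r.
apply: taylor1_ext tL => x x0; first by rewrite /band1 x0.
by rewrite /band0 ger0_norm.
Qed.

Lemma taylor1_band2 : exists L, taylor1_bound (fun=> True) band2 band1 L.
Proof.
have [L tL] := taylor1_half2; exists (2 * (L + L)).
apply: (@taylor1_sub _ _ (fun x => 0 <= - x \/ 0 <= x)) => [x _|].
  by rewrite oppr_ge0; case: (leP x 0) => [|/ltW]; [left|right].
apply: (@taylor1_glue _ _ _ 0) => //; rewrite ?oppr0 //.
- by move=> x; rewrite oppr_ge0.
- have N1 : `|1| = 1 :> R by rewrite normr1.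
  apply: taylor1_ext (taylor1_reflect N1 tL) => x; rewrite oppr_ge0 => x0.
    by rewrite /band2 ler0_norm // mul1r.
  rewrite /band1 mulN1r; case: ifP => // x0'.
  have -> : x = 0 by apply/eqP; rewrite eq_le x0 x0'.
  by rewrite oppr0 half1_0 oppr0.
apply: taylor1_ext tL => x x0; first by rewrite /band2 ger0_norm.
by rewrite /band1 x0.
Qed.

Definition band_sum (k q : nat) : R :=
  (\sum_(r < q) \sum_(s < q) band0 ((k * r)%:R / q%:R - s%:R / q%:R)) / q%:R ^+ 2.

Definition band_volume (k : nat) : R :=
  k%:R^-1 * (band2 k%:R - band2 (k%:R - 1) - band2 0 + band2 1).

(** Sum over s first: the Riemann sums of [band0] along a segment of length 1
    are increments of [band1], whose Riemann sums in r, with step k / q, are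
    increments of [band2] divided by k. *)
Lemma band_sum_approx k : (0 < k)%N ->
  exists C, forall q, (0 < q)%N -> `|band_sum k q - band_volume k| <= C / q%:R.
Proof.
move=> k0; have kn0 : k%:R != 0 :> R by rewrite pnatr_eq0 -lt0n.
have [L1 t1] := taylor1_band1; have [L2 t2] := taylor1_band2.
exists (L1 + 2 * L2 * k%:R) => q q0.
have qn0 : q%:R != 0 :> R by rewrite pnatr_eq0 -lt0n.
pose x (r : nat) : R := (k * r)%:R / q%:R.
pose I r := q%:R^-1 * \sum_(s < q) band0 (x r - s%:R / q%:R).
have Ir r : `|I r - (band1 (x r) - band1 (x r - 1))| <= L1 / q%:R.
  have := taylor1_riemann t1 (x r) (-1) q0.
  rewrite sqrrN expr1n mulr1; apply: le_trans; rewrite /I.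
  rewrite (eq_bigr (fun s : 'I_q => band0 (x r + -1 * (s%:R / q%:R)))) => [|s _]; last first.
    by rewrite mulN1r.
  by rewrite le_eqVlt; apply/orP; left; apply/eqP; congr (`| _ |); ring.
pose J := q%:R^-1 * \sum_(r < q) (band1 (x r) - band1 (x r - 1)).
have sJ : `|band_sum k q - J| <= L1 / q%:R.
  have -> : band_sum k q - J = q%:R^-1 * \sum_(r < q) (I r - (band1 (x r) - band1 (x r - 1))).
    rewrite sumrB mulrBr; congr (_ - _); rewrite /I -mulr_sumr /band_sum.
    by rewrite mulrA -expr2 exprVn mulrC.
  rewrite normrM ger0_norm ?invr_ge0 // ler_pdivrMl ?ltr0n //.
  apply: le_trans (ler_norm_sum _ _ _) _.
  apply: (@le_trans _ _ (\sum_(r < q) L1 / q%:R)); first by apply: ler_sum.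
  by rewrite sumr_const card_ord mulr_natl.
have outer y : `|band2 (y + k%:R) - band2 y - k%:R * (q%:R^-1 * \sum_(r < q) band1 (x r + y))|
    <= L2 * k%:R ^+ 2 / q%:R.
  have := taylor1_riemann t2 y k%:R q0; congr (`| _ - _ * (_ * _) | <= _).
  by apply: eq_bigr => r _; rewrite /x natrM mulrA addrC.
have o0 := outer 0; have o1 := outer (-1).
have JV : `|J - band_volume k| <= 2 * L2 * k%:R / q%:R.
  set S0 := q%:R^-1 * _ in o0; set S1 := q%:R^-1 * _ in o1.
  have JE : J = S0 - S1.
    rewrite /J /S0 /S1 -mulrBr -sumrB; congr (_ * _); apply: eq_bigr => r _.
    by rewrite addr0.
  have b2N : band2 (-1) = band2 1 by rewrite /band2 normrN1 normr1.
  rewrite b2N add0r in o0 o1.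
  have -> : J - band_volume k = k%:R^-1 *
      ((band2 (-1 + k%:R) - band2 1 - k%:R * S1) - (band2 k%:R - band2 0 - k%:R * S0)).
    by rewrite JE /band_volume [-1 + _]addrC; field.
  rewrite normrM ger0_norm ?invr_ge0 // ler_pdivrMl ?ltr0n //.
  apply: le_trans (ler_normB _ _) _; apply: le_trans (lerD o1 o0) _.
  by rewrite le_eqVlt; apply/orP; left; apply/eqP; field.
rewrite -(subrK J (band_sum k q)) -addrA (le_trans (ler_normD _ _)) //.
by rewrite mulrDl lerD.
Qed.

Lemma band2_far x : 0 <= x -> c <= x -> band2 x = P2.[c] + P1.[c] * (x - c).
Proof. by move=> x0 cx; rewrite /band2 /half2 ger0_norm // min_r. Qed.

Hypothesis P20 : P2.[0] = 0.

Lemma band2_0 : band2 0 = 0.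
Proof. by rewrite /band2 /half2 normr0 min_l // P20 subrr mulr0 addr0. Qed.

Lemma band_volume1 : c <= 1 -> band_volume 1 = 2 * ((1 - c) * P1.[c] + P2.[c]).
Proof.
move=> c1; rewrite /band_volume invr1 mul1r subrr band2_0 band2_far //; ring.
Qed.

Lemma band_volume_ge2 k : c <= 1 -> (2 <= k)%N ->
  band_volume k = k%:R^-1 * ((2 - c) * P1.[c] + P2.[c]).
Proof.
move=> c1 k2; have k2R : 2 <= k%:R :> R by rewrite ler_nat.
rewrite /band_volume band2_0 !band2_far //; lra.
Qed.

End Band.

(** * From lattice points to integrals *)

Section ElementarySymmetric.
Context (R : realType) (n : nat) (b : 'I_n -> nat).

Lemma elementary_symmetricE i :
  elementary_symmetric R b i =
  \sum_(h : {set 'I_n} | #|h| == i) \prod_(j in h) (b j)%:R.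
Proof. exact: mesym_meval. Qed.

Lemma elementary_symmetric1 i : (forall j, b j = 1%N) ->
  elementary_symmetric R b i = 'C(n, i)%:R.
Proof.
move=> b1; rewrite elementary_symmetricE.
rewrite (eq_bigr (fun=> 1)) => [|h _]; last by rewrite big1 // => j _; rewrite b1.
by rewrite sumr_const -[RHS](congr1 (fun m => m%:R) (congr1 (binomial^~ i) (card_ord n))) -card_draws cardsE.
Qed.

Lemma prod_oneB v : \prod_(j < n) (1 - (b j)%:R * v) =
  \sum_(i < n.+1) (-1) ^+ i * elementary_symmetric R b i * v ^+ i.
Proof.
rewrite (eq_bigr (fun j => - ((b j)%:R * v) + 1)); last by move=> j _; rewrite addrC.
rewrite bigA_distr (partition_big (fun h : {set 'I_n} => inord #|h| : 'I_n.+1) xpredT) //=.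
apply: eq_bigr => i _; rewrite elementary_symmetricE mulr_sumr mulr_suml.
have inordE (h : {set 'I_n}) : (inord #|h| == i :> 'I_n.+1) = (#|h| == i).
  by rewrite -val_eqE /= inordK // ltnS -[X in (_ <= X)%N]card_ord max_card.
apply: eq_big => [h|h]; rewrite inordE //= => /eqP hi.
rewrite -big_mkcond /= (eq_bigr (fun j => (-1) * (b j)%:R * v)) => [|j _]; last by ring.
by rewrite !big_split /= !prodr_const hi; ring.
Qed.

End ElementarySymmetric.

Section PolynomialIntegral.
Context (R : realType).

Lemma Rintegral_poly (p P : {poly R}) (c : R) : 0 < c -> P^`() = p ->
  \int[lebesgue_measure]_(x in `[0, c]) p.[x] = P.[c] - P.[0].
Proof.
move=> c0 Pp; rewrite /Rintegral (@continuous_FTC2 _ _ (horner P)) //.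
- by apply: continuous_subspaceT; exact: continuous_horner.
- split; first by move=> x _; exact: derivable_horner.
  + by apply: cvg_at_right_filter; exact: continuous_horner.
  + by apply: cvg_at_left_filter; exact: continuous_horner.
- by move=> x _; rewrite -derivE Pp.
Qed.

End PolynomialIntegral.

Section Antiderivatives.
Context (R : realType) (n : nat) (b : 'I_n -> nat).
Local Notation es i := ((-1) ^+ i * elementary_symmetric R b i).

(** The product \prod_i (1 - b_i X), expanded so that its antiderivatives can be
    written down. *)
Definition gap_poly : {poly R} := \sum_(i < n.+1) es i *: 'X^i.
Definition gap_poly1 : {poly R} := \sum_(i < n.+1) (es i / i.+1%:R) *: 'X^(i.+1).
Definition gap_poly2 : {poly R} :=
  \sum_(i < n.+1) (es i / i.+1%:R / i.+2%:R) *: 'X^(i.+2).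

Lemma deriv_gap_poly1 : gap_poly1^`() = gap_poly.
Proof.
rewrite [LHS]raddf_sum; apply: eq_bigr => i _; rewrite [LHS]derivZ derivXn /=.
by rewrite -scalerMnr scalerMnl -[(_ / _) *+ _]mulr_natr divfK // pnatr_eq0.
Qed.

Lemma deriv_gap_poly2 : gap_poly2^`() = gap_poly1.
Proof.
rewrite [LHS]raddf_sum; apply: eq_bigr => i _; rewrite [LHS]derivZ derivXn /=.
by rewrite -scalerMnr scalerMnl -[(_ / _) *+ _]mulr_natr divfK // pnatr_eq0.
Qed.

Lemma horner_gap_poly v : gap_poly.[v] = \prod_(j < n) (1 - (b j)%:R * v).
Proof.
rewrite prod_oneB horner_sum; apply: eq_bigr => i _.
by rewrite hornerZ hornerXn.
Qed.

Lemma horner_gap_poly1 v :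
  gap_poly1.[v] = \sum_(i < n.+1) es i * (v ^+ i.+1 / i.+1%:R).
Proof.
rewrite horner_sum; apply: eq_bigr => i _.
by rewrite hornerZ hornerXn -!mulrA [_ * v ^+ _]mulrC.
Qed.

Lemma gap_poly1_0 : gap_poly1.[0] = 0.
Proof.
by rewrite horner_gap_poly1 big1 // => i _; rewrite expr0n mul0r mulr0.
Qed.

Lemma gap_poly2_0 : gap_poly2.[0] = 0.
Proof.
by rewrite horner_sum big1 // => i _; rewrite hornerZ hornerXn expr0n mulr0.
Qed.

End Antiderivatives.

Section Counting.
Context (R : realType) (n : nat) (b : 'I_n -> nat) (n_gt0 : (0 < n)%N).
Hypothesis b_gt0 : forall i, (0 < b i)%N.
Local Notation b1 := (b (Ordinal n_gt0)).
Hypothesis b_max : forall i, (b i <= b1)%N.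
Local Notation c := (1 / b1%:R : R).

Lemma b1R_gt0 : 0 < b1%:R :> R. Proof. by rewrite ltr0n. Qed.

Lemma gap_poly_c : (gap_poly R b).[c] = 0.
Proof.
rewrite horner_gap_poly (bigD1 (Ordinal n_gt0)) //= mul1r divff ?subrr ?mul0r //.
by rewrite gt_eqF // b1R_gt0.
Qed.

(** For |x| > 1 / b_1 both sides vanish, on the left because of the factor of
    index 0. *)
Lemma gap_prod (k q r s : nat) : (0 < q)%N ->
  (\prod_(i < n) (q - facet_gap (fun i => k * b i) b r s i))%N%:R / q%:R ^+ n =
  band0 (gap_poly R b) c ((k * r)%:R / q%:R - s%:R / q%:R).
Proof.
move=> q0; have qR : 0 < q%:R :> R by rewrite ltr0n.
set x := _ - _.
have gapE i : (facet_gap (fun i => k * b i) b r s i)%:R = q%:R * ((b i)%:R * `|x|) :> R.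
  rewrite /facet_gap.
  have -> : x = ((k * r)%:R - s%:R) / q%:R by rewrite /x mulrBl.
  rewrite normrM [`|q%:R^-1|]ger0_norm ?invr_ge0 ?ltW //.
  rewrite (_ : q%:R * _ = (b i)%:R * `|(k * r)%:R - s%:R|); last by field; rewrite gt_eqF.
  case: (leqP (k * r) s) => h.
    have h' : (r * (k * b i) <= s * b i)%N by rewrite mulnA [(r * k)%N]mulnC leq_mul2r h orbT.
    rewrite (maxn_idPr h') (minn_idPl h') natrB // distrC ger0_norm ?subr_ge0 ?ler_nat //.
    by rewrite !natrM; ring.
  have h' : (s * b i <= r * (k * b i))%N by rewrite mulnA [(r * k)%N]mulnC leq_mul2r (ltnW h) orbT.
  rewrite (maxn_idPl h') (minn_idPr h') natrB // ger0_norm ?subr_ge0 ?ler_nat ?(ltnW h) //.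
  by rewrite !natrM; ring.
rewrite natr_prod /band0; case: (leP `|x| c) => xc; last first.
  rewrite gap_poly_c (bigD1 (Ordinal n_gt0)) //=.
  have /eqP-> : (q - facet_gap (fun i => k * b i)%N b r s (Ordinal n_gt0) == 0)%N.
    rewrite subn_eq0 -(ler_nat R) gapE -[leLHS]mulr1 ler_pM2l //.
    by rewrite -ler_pdivrMl ?b1R_gt0 // mulrC ltW.
  by rewrite !mul0r.
have nE : q%:R ^+ n = \prod_(i < n) q%:R :> R by rewrite prodr_const card_ord.
rewrite horner_gap_poly nE -prodf_div; apply: eq_bigr => i _.
rewrite natrB; first by rewrite gapE mulrBl divff ?gt_eqF // mulrAC divff ?gt_eqF // mul1r.
rewrite -(ler_nat R) gapE -[leRHS]mulr1 ler_pM2l //.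
apply: le_trans (_ : b1%:R * `|x| <= 1); first by rewrite ler_wpM2r // ler_nat.
by rewrite -ler_pdivlMl ?b1R_gt0 // mulrC.
Qed.

Lemma natr_count_eq (k q : nat) : (0 < q)%N ->
  (\sum_(r < q) \sum_(s < q) \prod_(i < n)
    (q - facet_gap (fun i => k * b i) b r s i))%N%:R / q%:R ^+ n.+2 =
  band_sum (gap_poly R b) c k q.
Proof.
move=> q0; rewrite /band_sum natr_sum -addn2 exprD invfM mulrA; congr (_ / _).
rewrite mulr_suml; apply: eq_bigr => r _; rewrite natr_sum mulr_suml.
by apply: eq_bigr => s _; rewrite gap_prod.
Qed.

End Counting.

Section Signature.
Context (R : realType) (K : fieldType) (p : nat) (chK : p \in [pchar K]).

Lemma local_max_free_rank n (a b : 'I_n -> nat) D e :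
  (forall i, 0 < a i)%N -> (forall i, 0 < b i)%N -> is_frobenius_degree K p D ->
  is_max_free_rank (Frobenius_push (pchar_local a b chK) e)
    (D ^ e * \sum_(r < p ^ e) \sum_(s < p ^ e) \prod_(i < n) (p ^ e - facet_gap a b r s i))%N.
Proof.
move=> a0 b0 KD.
exact: (Frobenius_max_free_rank chK a0 b0 e (pchar_local a b chK)
  (@to_local_inj K n a b) (@to_local_unit K n a b) (@local_fraction K n a b) KD).
Qed.

(** The factor D^e of the free rank cancels p^(e alpha) for
    alpha = log_p D. *)
Lemma F_signature_of_limit n (a b : 'I_n -> nat) (V : R) :
  (forall i, 0 < a i)%N -> (forall i, 0 < b i)%N -> F_finite K p ->
  (exists C : R, forall q, (0 < q)%N ->
    `|(\sum_(r < q) \sum_(s < q) \prod_(i < n) (q - facet_gap a b r s i))%N%:R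
       / q%:R ^+ n.+2 - V| <= C / q%:R) ->
  is_F_signature chK a b V.
Proof.
move=> a0 b0 [D KD] [C CP]; have D0 := is_frobenius_degree_gt0 KD.
have p_pr := pcharf_prime chK; have p1 := prime_gt1 p_pr.
have pR : 0 < p%:R :> R by rewrite ltr0n prime_gt0.
pose count e := (\sum_(r < p ^ e) \sum_(s < p ^ e) \prod_(i < n) (p ^ e - facet_gap a b r s i))%N.
have pD : p%:R `^ (ln D%:R / ln p%:R) = D%:R :> R.
  rewrite /powR gt_eqF // divfK ?lnK ?posrE ?ltr0n //.
  by rewrite gt_eqF // ln_gt0 // ltr1n.
exists n.+2, D, (ln D%:R / ln p%:R), (fun e => D ^ e * count e)%N; split=> //.
- exact: krull_dim_intersection.
- by move=> e; apply: local_max_free_rank.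
have q0 e : (0 < p ^ e)%N by rewrite expn_gt0 prime_gt0.
have uE e : (D ^ e * count e)%N%:R / p%:R `^ (e%:R * (n.+2%:R + ln D%:R / ln p%:R)) =
    (count e)%:R / (p ^ e)%N%:R ^+ n.+2 :> R.
  rewrite mulrC [e%:R * _]mulrC powRrM powRD; last by apply/implyP => _; rewrite gt_eqF.
  rewrite pD powR_mulrn ?ler0n // powR_mulrn ?mulr_ge0 ?exprn_ge0 ?ler0n //.
  rewrite exprMn natrM !natrX -!exprM [(e * _)%N]mulnC.
  have Dn : D%:R != 0 :> R by rewrite pnatr_eq0 -lt0n.
  have pn : p%:R != 0 :> R by rewrite gt_eqF.
  by field; rewrite !expf_neq0.
rewrite (_ : (fun e => _) = (fun e => (count e)%:R / (p ^ e)%N%:R ^+ n.+2)); last first.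
  by apply/funext => e; exact: uE.
have lim0 : (fun e => C / (p ^ e)%N%:R : R) @ \oo --> (0 : R).
  have pV1 : `|p%:R^-1| < 1 :> R.
    by rewrite ger0_norm ?invr_ge0 ?ler0n // invf_lt1 // ltr1n.
  have := cvg_geometric C pV1; rewrite (_ : geometric _ _ = (fun e => C / (p ^ e)%N%:R)) //.
  by apply/funext => e /=; rewrite natrX exprVn.
apply/cvgrPdist_le => eps eps0.
move/cvgrPdist_le: lim0 => /(_ _ eps0); apply: filterS => e.
rewrite sub0r normrN => h; rewrite distrC; apply: le_trans (CP _ (q0 e)) _.
exact: le_trans (ler_norm _) h.
Qed.

End Signature.

Theorem theorem3p6 (R : realType) (K : fieldType) (p : nat)
  (chK : p \in [pchar K]) (FfinK : F_finite K p)
  (n : nat) (n_gt0 : (0 < n)%N) (b : 'I_n -> nat)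
  (b_gt0 : forall i, (0 < b i)%N)
  (b_noninc : forall i j : 'I_n, (i <= j)%N -> (b j <= b i)%N)
  (k : nat) (k_gt0 : (0 < k)%N) :
  let b1 := b (Ordinal n_gt0) in
  let A : R :=
    \int[lebesgue_measure]_(u in `[0, 1 - 1 / b1%:R])
      \int[lebesgue_measure]_(v in `[0, 1 / b1%:R])
        \prod_(i < n) (1 - (b i)%:R * v) in
  let B : R :=
    \int[lebesgue_measure]_(u in `[0, 1 / b1%:R])
      \sum_(i < n.+1)
        (-1) ^+ i * elementary_symmetric R b i * (u ^+ i.+1 / i.+1%:R) in
  let Fsig := is_F_signature chK (fun i => (k * b i)%N) b in
  ((2 <= k)%N -> (2 <= b1)%N ->
     Fsig (1 / k%:R * ((2 * b1%:R - 1) / (b1%:R - 1) * A + B))) /\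
  ((2 <= k)%N -> b1 = 1%N ->
     Fsig (1 / k%:R *
       (\sum_(i < n.+1) (-1) ^+ i * ('C(n, i)%:R / i.+1%:R) + B))) /\
  (k = 1%N -> Fsig (2 * (A + B)) /\ (b1 = 1%N -> Fsig (2 * B))).
Proof.
move=> b1 A B Fsig.
have b1_gt0 : 0 < b1%:R :> R by rewrite ltr0n b_gt0.
have b_max i : (b i <= b1)%N by apply: b_noninc; exact: leq0n.
set c : R := 1 / b1%:R.
have c_gt0 : 0 < c by rewrite /c mul1r invr_gt0.
have c_le1 : c <= 1 by rewrite /c mul1r invf_le1 // ler1n b_gt0.
pose P1 := gap_poly1 R b; pose P2 := gap_poly2 R b.
have dP1 : P1^`() = gap_poly R b := deriv_gap_poly1 R b.
have dP2 : P2^`() = P1 := deriv_gap_poly2 R b.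
have AE : A = (1 - c) * P1.[c].
  rewrite /A; have -> : \int[lebesgue_measure]_(v in `[0, c]) \prod_(i < n) (1 - (b i)%:R * v) = P1.[c].
    have := Rintegral_poly c_gt0 dP1; rewrite gap_poly1_0 subr0 => <-.
    by apply: eq_Rintegral => v _; rewrite horner_gap_poly.
  rewrite Rintegral_cst // mulrC; congr (_ * _).
  rewrite -/c; apply: (etrans (congr1 fine (lebesgue_measure_itv `[0, 1 - c]))) => /=.
  rewrite lte_fin subr_gt0; case: ltgtP c_le1 => //= [c1|->] _; last by rewrite subrr.
  by rewrite oppr0 addr0.
have BE : B = P2.[c].
  have := Rintegral_poly c_gt0 dP2; rewrite gap_poly2_0 subr0 => <-.
  by apply: eq_Rintegral => u _; rewrite horner_gap_poly1.
have main V : V = band_volume P1 P2 c k -> Fsig V.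
  move=> ->; apply: F_signature_of_limit => // [i|]; first by rewrite muln_gt0 k_gt0 b_gt0.
  have [C CP] := band_sum_approx (ltW c_gt0) dP1 dP2 (gap_poly_c R n_gt0 b_gt0) (gap_poly1_0 R b) k_gt0.
  by exists C => q q0; rewrite (natr_count_eq R b_gt0 b_max) //; exact: CP.
split; [|split].
- move=> k2 b12; apply: main.
  rewrite (band_volume_ge2 P1 (ltW c_gt0) (gap_poly2_0 R b) c_le1 k2) AE BE mul1r; congr (_ * (_ + _)).
  rewrite mulrA; congr (_ * _); rewrite /c.
  have b1n : b1%:R - 1 != 0 :> R by rewrite subr_eq0 pnatr_eq1 gtn_eqF.
  by field; rewrite b1n gt_eqF.
- move=> k2 b11; apply: main.
  rewrite (band_volume_ge2 P1 (ltW c_gt0) (gap_poly2_0 R b) c_le1 k2) BE mul1r; congr (_ * (_ + _)).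
  have c1 : c = 1 by rewrite /c b11 divr1.
  have bi1 j : b j = 1%N by apply/eqP; rewrite eqn_leq b_gt0 -b11 b_max.
  rewrite c1 /P1 horner_gap_poly1; rewrite (_ : 2 - 1 = 1) ?mul1r; last by ring.
  apply: eq_bigr => i _; rewrite elementary_symmetric1 // expr1n mulrA; ring.
move=> k1; have V1 : band_volume P1 P2 c k = 2 * (A + B).
  by rewrite k1 (band_volume1 P1 (ltW c_gt0) (gap_poly2_0 R b) c_le1) AE BE.
split=> [|b11]; first exact: main.
apply: main; rewrite V1 AE; have -> : c = 1 by rewrite /c b11 divr1.
by rewrite subrr mul0r add0r.
Qed.
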